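(* Consider the following problem (SCO). Let $f\colon\mathbb{R}^d\to\mathbb{R}$ be a differentiable convex function that is $L$-Lipschitz with respect to the Euclidean norm and has a minimizer $x^\star\in\operatorname{argmin}_{x\in\mathbb{R}^d}f(x)$ with $\|x^\star\|\le R$; given access to a stochastic gradient oracle for $f$ and a target accuracy $\epsilon>0$, output an $\epsilon$-optimal point of $f$. For every $\sigma_E>0$, this problem can be solved with probability at least $2/3$ using $\tilde O\left(R^2\sigma_E^2/\epsilon^2+d\right)$ queries to a $\sigma_E$-ESGO for $f$.
   Context: $\|\cdot\|$ is the Euclidean norm. A point $x$ is $\epsilon$-optimal if $f(x)\le \inf_y f(y)+\epsilon$. A stochastic gradient oracle (SGO) for differentiable $f$ is an oracle $\mathcal{O}$ which, when queried at $x\in\mathbb{R}^d$, outputs a random vector $\mathcal{O}(x)\in\mathbb{R}^d$ with $\mathbb{E}\,\mathcal{O}(x)=\nabla f(x)$; the randomness of each call is independent of previous calls. A $\sigma_E$-sub-exponential SGO ($\sigma_E$-ESGO) is an SGO $\mathcal{O}_E$ for $f$ such that for all $x,u\in\mathbb{R}^d$ with $\|u\|=1$ and all $t\ge0$, $\mathbb{P}\left[|\langle \mathcal{O}_E(x)-\nabla f(x),u\rangle|\ge t\right]\le 2\exp(-t\sqrt d/\sigma_E)$. $\tilde O(\cdot)$ hides polylogarithmic factors in $1/\epsilon$, $d$, $R$, $L$. *)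

(* Defs.v *)
From HB Require Import structures.
From mathcomp Require Import all_boot all_order all_algebra.
From mathcomp Require Import all_classical all_reals all_analysis.

Set Implicit Arguments.
Unset Strict Implicit.
Unset Printing Implicit Defensive.

Import Order.TTheory GRing.Theory Num.Theory.
Import numFieldNormedType.Exports.

Local Open Scope classical_set_scope.
Local Open Scope ring_scope.

Definition dotp (R : realType) (d : nat) (x y : 'rV[R]_d) : R :=
  \sum_i x ord0 i * y ord0 i.

(* The norm `|x| that the library puts on row vectors is the sup norm. *)
Definition enorm (R : realType) (d : nat) (x : 'rV[R]_d) : R :=
  Num.sqrt (dotp x x).

Definition gradient (R : realType) (d : nat) (f : 'rV[R]_d -> R)
    (x : 'rV[R]_d) : 'rV[R]_d :=
  \row_i 'D_(delta_mx ord0 i) f x.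

Definition elipschitz (R : realType) (d : nat) (L : R) (f : 'rV[R]_d -> R) :=
  forall x y, `|f x - f y| <= L * enorm (x - y).

Definition minimizer (R : realType) (d : nat) (f : 'rV[R]_d -> R)
    (x : 'rV[R]_d) :=
  forall y, f x <= f y.

Definition sco_instance (R : realType) (d : nat) (L rad : R)
    (f : 'rV[R]_d -> R) : Prop :=
  [/\ forall x, differentiable f x,
      @convex_function R 'rV[R]_d setT f,
      elipschitz L f &
      exists2 x, minimizer f x & enorm x <= rad].

Definition eps_optimal (R : realType) (d : nat) (eps : R) (f : 'rV[R]_d -> R)
    (x : 'rV[R]_d) :=
  f x <= inf (range f) + eps.

(* R^d with its Borel sigma-algebra. *)
Definition borel_rV (R : realType) (d : nat) : measurableType _ :=
  g_sigma_algebraType (@open 'rV[R]_d).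

(* An oracle is given by the probability space (Omega, P) of the randomness of
   a single call: O x w is the answer to the query x when the call draws w.  An
   expectation that is equal to a real number is that of an integrable
   variable. *)
Definition is_SGO (R : realType) (d : nat) (dO : measure_display)
    (Omega : measurableType dO) (P : probability Omega R)
    (f : 'rV[R]_d -> R) (O : 'rV[R]_d -> Omega -> 'rV[R]_d) : Prop :=
  forall x,
    measurable_fun setT (O x : Omega -> borel_rV R d) /\
    forall i, ('E_P[fun w => O x w ord0 i] = (gradient f x ord0 i)%:E)%E.

Definition is_ESGO (R : realType) (d : nat) (dO : measure_display)
    (Omega : measurableType dO) (P : probability Omega R)
    (sigma : R) (f : 'rV[R]_d -> R)
    (O : 'rV[R]_d -> Omega -> 'rV[R]_d) : Prop :=
  is_SGO P f O /\
  forall (x u : 'rV[R]_d) (t : R), enorm u = 1 -> 0 <= t ->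
    (P [set w | (t <= `|dotp (O x w - gradient f x) u|)%R] <=
       (2 * expR (- (t * Num.sqrt d%:R / sigma)))%:E)%E.

(* A randomized adaptive algorithm making N queries: with internal randomness s,
   its query number t (counted from 0) is query t s h, where h lists the t
   answers received so far.  It sees nothing of the instance but the answers. *)
Record algorithm (R : realType) (d N : nat) := Algorithm {
  seed_display : measure_display ;
  seed : measurableType seed_display ;
  seed_law : probability seed R ;
  query : forall t : nat, seed -> t.-tuple (borel_rV R d) -> borel_rV R d ;
  output : seed -> N.-tuple (borel_rV R d) -> borel_rV R d ;
  measurable_query : forall t : nat,
    measurable_fun setT (fun p : seed * t.-tuple (borel_rV R d) =>
                           query p.1 p.2) ;
  measurable_output :
    measurable_fun setT (fun p : seed * N.-tuple (borel_rV R d) =>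
                           output p.1 p.2)
}.

(* The first t answers, when the t-th call (from 0) answers a query x by
   answer t x. *)
Fixpoint answers (R : realType) (d N : nat) (A : algorithm R d N)
    (s : seed A) (answer : nat -> 'rV[R]_d -> 'rV[R]_d) (t : nat) :
    t.-tuple (borel_rV R d) :=
  match t with
  | 0 => [tuple]
  | t'.+1 => let h := answers s answer t' in
             [tuple of rcons h (answer t' (query s h))]
  end.

Definition run (R : realType) (d N : nat) (A : algorithm R d N)
    (s : seed A) (answer : nat -> 'rV[R]_d -> 'rV[R]_d) : 'rV[R]_d :=
  output s (answers s answer N).

(* zeta has law Q, the xi t for t < N have law P, and all of them are mutually
   independent: their joint law is the product law. *)
Definition independent_draws (R : realType)
    (dW dS dO : measure_display) (W : measurableType dW)
    (S : measurableType dS) (Omega : measurableType dO)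
    (Pr : probability W R) (Q : probability S R) (P : probability Omega R)
    (N : nat) (zeta : W -> S) (xi : nat -> W -> Omega) : Prop :=
  [/\ measurable_fun setT zeta,
      forall t, (t < N)%N -> measurable_fun setT (xi t) &
      forall (A : set S) (B : nat -> set Omega),
        measurable A -> (forall t, measurable (B t)) ->
        Pr (zeta @^-1` A `&` \bigcap_(t in `I_N) (xi t @^-1` B t)) =
        (Q A * \prod_(t < N) P (B t))%E].

(* With O not assumed jointly measurable in the query and the randomness, the
   success event need not be measurable: that its probability is at least p
   means that it contains an event of probability at least p. *)
Definition solves_with_ESGO (R : realType) (d N : nat)
    (A : algorithm R d N) (L rad eps sigma p : R) : Prop :=
  forall f : 'rV[R]_d -> R, sco_instance L rad f ->
  forall (dO : measure_display) (Omega : measurableType dO)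
         (P : probability Omega R) (O : 'rV[R]_d -> Omega -> 'rV[R]_d),
    is_ESGO P sigma f O ->
  forall (dW : measure_display) (W : measurableType dW)
         (Pr : probability W R) (zeta : W -> seed A) (xi : nat -> W -> Omega),
    independent_draws Pr (seed_law A) P N zeta xi ->
  exists E : set W,
    [/\ measurable E,
        E `<=` [set w | eps_optimal eps f
                          (run (zeta w) (fun t x => O x (xi t w)))] &
        (p%:E <= Pr E)%E].

(* Main.v *)
Require Import Defs.
From HB Require Import structures.
From mathcomp Require Import all_boot all_order all_algebra.
From mathcomp Require Import all_classical all_reals all_analysis.
From mathcomp Require Import perm measurable_realfun ring lra.

(* A cutting-plane method whose query points are the centres of (nearly) maximal
   ellipsoids inscribed in the region left.  Let E be such an ellipsoid and E' an
   ellipsoid in the part of the region cut off by a half-space through the centre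
   of E.  In coordinates where E is the unit ball and E' has semi-axes D_i along
   the coordinate axes and centre c, the convex hull of E and E' contains the
   ellipsoids centred at c/2 with shape matrices (1 + D)^2 / 4 and D + c c^T / 4;
   as neither is much larger than E, the volume of E' is smaller than that of E
   by a constant factor.  Hence O(d log) cuts suffice, and each cut only needs
   the error of the gradient in the direction of the minimizer to be small: a
   batch of about R^2 sigma^2 / (d eps^2) queries, by Bernstein's inequality.

   When no point of the ball is deep inside all cuts, duality gives convex weights
   certifying that the weighted average of the query points is nearly optimal, so
   that the best query point does not have to be identified.

   The answers are rounded to a grid.  The history of the run then takes countably
   many values: the algorithm may use arbitrary choices without losing
   measurability, and the oracle need not be jointly measurable. *)

Set Implicit Arguments.
Unset Strict Implicit.
Unset Printing Implicit Defensive.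

Import Order.TTheory GRing.Theory Num.Theory.
Import numFieldNormedType.Exports.

Local Open Scope classical_set_scope.
Local Open Scope ring_scope.

(** * Euclidean vectors *)

Section Euclidean.
Variables (R : realType) (d : nat).
Implicit Types (x y z u : 'rV[R]_d) (a : R).

(** The volume of an ellipsoid is [|\det A|] up to a constant, so the progress made by a cut is a
    matter of linear algebra, and volumes of general convex bodies never enter.

    Along a fixed unit direction an answer errs by about sigma / sqrt d. The resulting factor 1/d in
    the batch size cancels the d of the number of cuts and leaves R^2 sigma^2 / eps^2; the additive
    term d stems from batches having at least one query. The minimizer serves as a direction only in
    the analysis. The coordinate directions are controlled too, but merely to bound the norms of the
    batch means, and that bound enters the count through a logarithm.

    The obstacle is adaptivity: the query point, and with it the direction of interest, depends on
    earlier answers. Fixing the rounded history fixes both and turns the past into a rectangle in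
    the draws, the only kind of event for which independence is given. The deviation bound is
    proportional to the probability of that rectangle, so it can be summed over all histories. *)

Lemma dotp_mx x y : dotp x y = (x *m y^T) ord0 ord0.
Proof. by rewrite !mxE; apply: eq_bigr => i _; rewrite mxE. Qed.

Lemma dotpC x y : dotp x y = dotp y x.
Proof. by apply: eq_bigr => i _; rewrite mulrC. Qed.

Lemma dotpDl x y z : dotp (x + y) z = dotp x z + dotp y z.
Proof. by rewrite !dotp_mx mulmxDl mxE. Qed.

Lemma dotpZl a x y : dotp (a *: x) y = a * dotp x y.
Proof. by rewrite !dotp_mx -scalemxAl mxE. Qed.

Lemma dotpDr x y z : dotp z (x + y) = dotp z x + dotp z y.
Proof. by rewrite dotpC dotpDl !(dotpC z). Qed.

Lemma dotpZr a x y : dotp x (a *: y) = a * dotp x y.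
Proof. by rewrite dotpC dotpZl dotpC. Qed.

Lemma dotpNl x y : dotp (- x) y = - dotp x y.
Proof. by rewrite -scaleN1r dotpZl mulN1r. Qed.

Lemma dotpNr x y : dotp x (- y) = - dotp x y.
Proof. by rewrite dotpC dotpNl dotpC. Qed.

Lemma dotpBl x y z : dotp (x - y) z = dotp x z - dotp y z.
Proof. by rewrite dotpDl dotpNl. Qed.

Lemma dotpBr x y z : dotp z (x - y) = dotp z x - dotp z y.
Proof. by rewrite dotpDr dotpNr. Qed.

Lemma dotp0l x : dotp 0 x = 0.
Proof. by rewrite -(scale0r x) dotpZl mul0r. Qed.

Lemma dotp0r x : dotp x 0 = 0.
Proof. by rewrite dotpC dotp0l. Qed.

Lemma dotp_suml (I : finType) (F : I -> 'rV[R]_d) y :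
  dotp (\sum_i F i) y = \sum_i dotp (F i) y.
Proof.
by apply: (big_ind2 (fun u v => dotp u y = v)) => [|u _ v _ <- <-|//];
  rewrite ?dotp0l ?dotpDl.
Qed.

Lemma dotp_sumr (I : finType) (F : I -> 'rV[R]_d) y :
  dotp y (\sum_i F i) = \sum_i dotp y (F i).
Proof. by rewrite dotpC dotp_suml; apply: eq_bigr => i _; rewrite dotpC. Qed.

Lemma dotp_ge0 x : 0 <= dotp x x.
Proof. by apply: sumr_ge0 => i _; rewrite -expr2 sqr_ge0. Qed.

Lemma dotp_eq0 x : (dotp x x == 0) = (x == 0).
Proof.
apply/eqP/eqP => [|->]; last by rewrite dotp0l.
move=> /eqP; rewrite psumr_eq0 => [/allP h|i _]; last by rewrite -expr2 sqr_ge0.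
apply/rowP => i; rewrite mxE.
by have := h i (mem_index_enum i); rewrite mulf_eq0 orbb => /eqP.
Qed.

Lemma dotp_delta x i : dotp x (delta_mx ord0 i) = x ord0 i.
Proof.
rewrite /dotp (bigD1 i)//= mxE !eqxx mulr1 big1 ?addr0// => j ji.
by rewrite mxE (negbTE ji) andbF mulr0.
Qed.

Lemma dotp_sqrD x y : dotp (x + y) (x + y) = dotp x x + 2 * dotp x y + dotp y y.
Proof. by rewrite dotpDl !dotpDr (dotpC y x); ring. Qed.

Lemma dotp_CS x y : dotp x y ^+ 2 <= dotp x x * dotp y y.
Proof.
have [->|y0] := eqVneq y 0; first by rewrite !dotp0r expr0n/= mulr0.
have yy : 0 < dotp y y by rewrite lt0r dotp_eq0 y0 dotp_ge0.
have := dotp_ge0 (dotp y y *: x - dotp x y *: y).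
rewrite dotpBl !dotpBr !dotpZl !dotpZr (dotpC y x).
rewrite (_ : _ - _ = dotp y y * (dotp x x * dotp y y - dotp x y ^+ 2)); last by ring.
by rewrite pmulr_rge0// subr_ge0.
Qed.

Lemma enorm_ge0 x : 0 <= enorm x. Proof. exact: sqrtr_ge0. Qed.

Lemma sqr_enorm x : enorm x ^+ 2 = dotp x x.
Proof. by rewrite sqr_sqrtr ?dotp_ge0. Qed.

Lemma enorm0 : enorm (0 : 'rV[R]_d) = 0.
Proof. by rewrite /enorm dotp0l sqrtr0. Qed.

Lemma enorm_eq0 x : (enorm x == 0) = (x == 0).
Proof. by rewrite -dotp_eq0 -sqr_enorm expf_eq0. Qed.

Lemma enorm_gt0 x : (0 < enorm x) = (x != 0).
Proof. by rewrite lt0r enorm_eq0 enorm_ge0 andbT. Qed.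

Lemma enorm_le x a : 0 <= a -> (enorm x <= a) = (dotp x x <= a ^+ 2).
Proof. by move=> a0; rewrite -sqr_enorm ler_sqr ?nnegrE ?enorm_ge0. Qed.

Lemma dotp_enorm_abs x y : `|dotp x y| <= enorm x * enorm y.
Proof.
rewrite -ler_sqr ?nnegrE ?mulr_ge0 ?enorm_ge0//.
by rewrite exprMn !sqr_enorm real_normK ?num_real// dotp_CS.
Qed.

Lemma dotp_enorm x y : dotp x y <= enorm x * enorm y.
Proof. exact: le_trans (ler_norm _) (dotp_enorm_abs x y). Qed.

Lemma enormZ a x : enorm (a *: x) = `|a| * enorm x.
Proof. by rewrite /enorm dotpZl dotpZr mulrA -expr2 sqrtrM ?sqr_ge0// sqrtr_sqr. Qed.

Lemma enormN x : enorm (- x) = enorm x.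
Proof. by rewrite -scaleN1r enormZ normrN1 mul1r. Qed.

Lemma enormD x y : enorm (x + y) <= enorm x + enorm y.
Proof.
rewrite enorm_le ?addr_ge0 ?enorm_ge0// dotp_sqrD sqrrD !sqr_enorm.
by rewrite lerD2r lerD2l mulr2n mulrDl !mul1r lerD// dotp_enorm.
Qed.

Lemma enormB x y : enorm (x - y) <= enorm x + enorm y.
Proof. by rewrite -(enormN y) enormD. Qed.

Lemma enorm_delta i : enorm (delta_mx ord0 i : 'rV[R]_d) = 1.
Proof. by rewrite /enorm dotp_delta mxE !eqxx sqrtr1. Qed.

Lemma coord_le_enorm x i : `|x ord0 i| <= enorm x.
Proof. by rewrite -dotp_delta (le_trans (dotp_enorm_abs _ _))// enorm_delta mulr1. Qed.

(** The factor sqrt d would be sharp. The cruder d is harmless: it affects only the grid width and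
    quantities that appear under a logarithm. *)
Lemma enorm_le_coord x a : (forall i, `|x ord0 i| <= a) -> enorm x <= a * d%:R.
Proof.
move=> h; have [d0|d0] := posnP d.
  by rewrite /enorm /dotp big1 ?sqrtr0 ?d0 ?mulr0// => i; have := ltn_ord i; rewrite {2}d0.
have a0 : 0 <= a by rewrite (le_trans _ (h (Ordinal d0))).
rewrite enorm_le ?mulr_ge0//.
apply: (@le_trans _ _ (\sum_(i < d) a ^+ 2)).
  by apply: ler_sum => i _; rewrite -expr2 -real_normK ?num_real// ler_sqr ?nnegrE.
rewrite sumr_const card_ord -[_ *+ _]mulr_natr exprMn ler_wpM2l ?sqr_ge0//.
by rewrite -natrX ler_nat -{1}(expn1 d) leq_pexp2l.
Qed.

End Euclidean.

Lemma dotp_mulmx (R : realType) (m n : nat) (A : 'M[R]_(m, n)) x y :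
  dotp (x *m A) y = dotp x (y *m A^T).
Proof. by rewrite !dotp_mx trmx_mul trmxK mulmxA. Qed.

Lemma dotp_orthogonal (R : realType) (n : nat) (U : 'M[R]_n) x y :
  U *m U^T = 1%:M -> dotp (x *m U) (y *m U) = dotp x y.
Proof. by move=> UU; rewrite dotp_mulmx -mulmxA UU mulmx1. Qed.

Lemma enorm_orthogonal (R : realType) (n : nat) (U : 'M[R]_n) x :
  U *m U^T = 1%:M -> enorm (x *m U) = enorm x.
Proof. by move=> UU; rewrite /enorm dotp_orthogonal. Qed.

Lemma det_orthogonal (R : realType) (n : nat) (U : 'M[R]_n) :
  U *m U^T = 1%:M -> `|\det U| = 1.
Proof.
move=> UU; apply/eqP; rewrite -sqrp_eq1 ?normr_ge0// real_normK ?num_real//.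
by rewrite expr2 -{2}det_tr -det_mulmx UU det1.
Qed.

(** * Singular value decomposition *)

Section Compactness.
Variable R : realType.

Lemma continuous_sum (T : topologicalType) (I : finType) (F : I -> T -> R) :
  (forall i, continuous (F i)) -> continuous (fun x => \sum_i F i x).
Proof. by move=> cF; apply: continuous_big => //; exact: add_continuous. Qed.

Lemma continuousM_fun (T : topologicalType) (f g : T -> R) :
  continuous f -> continuous g -> continuous (fun x => f x * g x).
Proof. by move=> cf cg x; apply: continuousM; [exact: cf|exact: cg]. Qed.

Lemma continuousD_fun (T : topologicalType) (f g : T -> R) :
  continuous f -> continuous g -> continuous (fun x => f x + g x).
Proof. by move=> cf cg x; apply: continuousD; [exact: cf|exact: cg]. Qed.

Lemma continuous_dotp_mulmx (m n : nat) (A B : 'M[R]_(m, n)) :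
  continuous (fun x : 'rV[R]_m => dotp (x *m A) (x *m B)).
Proof.
have cmx (C : 'M[R]_(m, n)) i : continuous (fun x : 'rV[R]_m => (x *m C) ord0 i).
  rewrite (_ : (fun _ => _) = fun x : 'rV[R]_m => \sum_j x ord0 j * C j i).
    apply: continuous_sum => j; apply: continuousM_fun.
      exact: coord_continuous.
    exact: cst_continuous.
  by apply/funext => x; rewrite mxE.
by apply: continuous_sum => i; apply: continuousM_fun; exact: cmx.
Qed.

Lemma coord_bounded_compact (n : nat) (A : set 'rV[R]_n) (M : R) :
  closed A -> (forall x, A x -> forall i, `|x ord0 i| <= M) -> compact A.
Proof.
move=> clA AM; apply: bounded_closed_compact => //.
exists (Num.max M 0); split; first exact: num_real.
move=> N; rewrite gt_max => /andP[MN N0] x Ax /=.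
rewrite [leLHS]/Num.norm /= mx_normrE; apply: bigmax_le; first exact: ltW.
by move=> [i j] _ /=; rewrite ord1 (le_trans (AM _ Ax j))// ltW.
Qed.

(** By compactness of the sphere. The maximiser becomes the first singular vector in the induction
    for [svd]. *)
Lemma argmax_sphere (n : nat) (A : 'M[R]_n.+1) :
  exists2 u : 'rV[R]_n.+1, dotp u u = 1 &
    forall v, dotp (v *m A) (v *m A) <= dotp (u *m A) (u *m A) * dotp v v.
Proof.
pose S := [set u : 'rV[R]_n.+1 | dotp u u = 1].
have S0 : S !=set0 by exists (delta_mx ord0 ord0); rewrite /S/= dotp_delta mxE !eqxx.
have cS : compact S.
  apply: (@coord_bounded_compact _ _ 1) => [|x Sx i].
    have cd : continuous (fun u : 'rV[R]_n.+1 => dotp u u).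
      rewrite (_ : (fun _ => _) = fun u : 'rV[R]_n.+1 => dotp (u *m 1%:M) (u *m 1%:M)).
        exact: continuous_dotp_mulmx.
      by apply/funext => u; rewrite mulmx1.
    exact: (continuous_closedP _).1 cd _ (@closed_eq R 1).
  by rewrite (le_trans (coord_le_enorm x i))// enorm_le// expr1n Sx.
have [u uS umax] := EVT_max_rV S0 cS
  (continuous_subspaceT (@continuous_dotp_mulmx _ _ A A)).
exists u; first by move: uS; rewrite inE.
move=> v; have [->|v0] := eqVneq v 0; first by rewrite mul0mx !dotp0l mulr0.
have e0 : enorm v != 0 by rewrite enorm_eq0.
have := umax ((enorm v)^-1 *: v).
rewrite -scalemxAl !dotpZl !dotpZr mulrA -expr2 exprVn sqr_enorm => h.
rewrite -ler_pdivrMr ?lt0r ?dotp_eq0 ?v0 ?dotp_ge0// mulrC; apply: h.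
by rewrite inE /S/= dotpZl dotpZr mulrA -expr2 exprVn sqr_enorm mulVf// dotp_eq0.
Qed.

End Compactness.

Section SVD.
Variable R : realType.

(* Householder reflection. *)
Lemma orthogonal_with_row0 (n : nat) (u : 'rV[R]_n.+1) : dotp u u = 1 ->
  exists2 U : 'M[R]_n.+1, U *m U^T = 1%:M & row ord0 U = u.
Proof.
move=> uu; pose e : 'rV[R]_n.+1 := delta_mx ord0 ord0.
have ee : dotp e e = 1 by rewrite /e dotp_delta mxE !eqxx.
have [ue|ue] := eqVneq (e - u) 0.
  exists 1%:M; first by rewrite trmx1 mulmx1.
  by rewrite rowE mulmx1 -/e; apply/eqP; rewrite -subr_eq0; apply/eqP.
set w := e - u in ue.
have ww0 : dotp w w != 0 by rewrite dotp_eq0.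
have ew : dotp e w = dotp w w / 2.
  by rewrite /w dotpBl !dotpBr ee uu (dotpC u e); field.
have wE : w = e - u by [].
clearbody w; have wwT : w *m w^T = (dotp w w)%:M.
  by apply/matrixP => i j; rewrite !ord1 [RHS]mxE/= mulr1n dotp_mx.
exists (1%:M - (2 / dotp w w) *: (w^T *m w)).
  have -> : (1%:M - (2 / dotp w w) *: (w^T *m w))^T =
      1%:M - (2 / dotp w w) *: (w^T *m w).
    by rewrite [LHS]linearB/= trmx1 [in LHS]linearZ/= trmx_mul trmxK.
  rewrite mulmxBl mul1mx mulmxBr. rewrite mulmx1 -scalemxAl -scalemxAr.
  rewrite mulmxA -(mulmxA w^T w) wwT mul_mx_scalar -scalemxAl !scalerA.
  rewrite -scalerBl -addrA -opprD -scalerDl (_ : 2 / dotp w w + _ = 0) ?scale0r ?subr0//.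
  by field.
rewrite rowE -/e mulmxBr mulmx1 -scalemxAr mulmxA.
have -> : e *m w^T = (dotp e w)%:M.
  by apply/matrixP => i j; rewrite !ord1 [RHS]mxE/= mulr1n dotp_mx.
have c1 : 2 / dotp w w * (dotp w w / 2) = 1 by field.
rewrite mul_scalar_mx scalerA ew c1 scale1r wE.
by rewrite opprB addrC subrK.
Qed.

(** Deflation: [u] maximises |uA| on the unit sphere and [v] is uA normalised. Completed to
    orthogonal matrices, they make the first row of U A V^T vanish off the diagonal by orthogonality
    and the first column by maximality; the induction continues in the remaining block. *)
Lemma svd (n : nat) (A : 'M[R]_n) :
  exists (U V : 'M[R]_n), exists2 D : 'rV[R]_n,
    [/\ U *m U^T = 1%:M, V *m V^T = 1%:M & forall i, 0 <= D ord0 i] &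
    A = U^T *m diag_mx D *m V.
Proof.
elim: n A => [|n IHn] A.
  exists 1%:M, 1%:M, 0; last by apply/matrixP => -[].
  by split; [apply/matrixP => -[]|apply/matrixP => -[]|case].
have [u uu umax] := argmax_sphere A.
set s := dotp (u *m A) (u *m A) in umax.
have s0 : 0 <= s := dotp_ge0 _.
have [s_eq0|s_neq0] := eqVneq s 0.
  have A0 : A = 0.
    apply/row_matrixP => i; rewrite rowE row0; apply/eqP; rewrite -dotp_eq0.
    by rewrite eq_le dotp_ge0 andbT (le_trans (umax _))// s_eq0 mul0r.
  exists 1%:M, 1%:M, 0; first by rewrite trmx1 mulmx1; split=> // i; rewrite mxE.
  by rewrite A0 mulmx1 trmx1 mul1mx; apply/matrixP => i j; rewrite !mxE mul0rn.
pose r := Num.sqrt s.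
have r0 : r != 0 by rewrite sqrtr_eq0 -ltNge lt0r s_neq0.
have rr : r * r = s by rewrite -expr2 sqr_sqrtr.
pose v := r^-1 *: (u *m A).
have vv : dotp v v = 1 by rewrite dotpZl dotpZr -/s -rr mulrA -invfM mulVf ?mulf_neq0.
have uA : u *m A = r *: v by rewrite scalerA mulfV ?scale1r.
have [U UU U0] := orthogonal_with_row0 uu.
have [V VV V0] := orthogonal_with_row0 vv.
have UU' := mulmx1C UU; have VV' := mulmx1C VV.
have rowdotp (W : 'M[R]_n.+1) i j : W *m W^T = 1%:M ->
    dotp (row i W) (row j W) = (i == j)%:R.
  by move=> WW; rewrite rowE (rowE j) dotp_orthogonal// dotp_delta mxE eqxx/= eq_sym.
pose B := U *m A *m V^T.
have BE i j : B i j = dotp (row i U *m A) (row j V).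
  rewrite dotp_mx -row_mul tr_row /B [LHS]mxE [RHS]mxE.
  by apply: eq_bigr => k _; rewrite [row _ _ _ _]mxE [col _ _ _ _]mxE.
have B0j j : B ord0 j = r * (ord0 == j)%:R.
  by rewrite BE U0 uA dotpZl -V0 rowdotp.
have Bi0 i : i != ord0 -> B i ord0 = 0.
  move=> i0; rewrite BE V0 dotpC.
  have ort : dotp u (row i U) = 0.
    by rewrite -U0 rowdotp// eq_sym (negbTE i0).
  set z := row i U in ort *; set q := dotp v (z *m A).
  (* the maximum of |xA|^2 - s |x|^2 along the line u + t z is at t = 0 *)
  have key t : 2 * t * (r * q) <= t ^+ 2 * s.
    have zz : dotp z z = 1 by rewrite rowdotp// eqxx.
    have := umax (u + t *: z); rewrite mulmxDl -scalemxAl !dotp_sqrD.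
    rewrite !dotpZr !dotpZl uu ort zz -/s uA dotpZl -/q.
    have := dotp_ge0 (z *m A); set Q := dotp (z *m A) _ => Q0.
    have := mulr_ge0 (sqr_ge0 t) Q0; lra.
  (* This t minimises t^2 s - 2 t r q, and there the inequality forces (r q)^2 / s <= 0. *)
  have := key (r * q / s).
  rewrite (_ : 2 * _ * _ = 2 * (r * q) ^+ 2 / s); last by field.
  rewrite (_ : _ ^+ 2 * s = (r * q) ^+ 2 / s); last by field.
  have : 0 <= (r * q) ^+ 2 / s by rewrite divr_ge0 ?sqr_ge0.
  move=> p1 p2; have : (r * q) ^+ 2 / s == 0 by rewrite eq_le p1 andbT; lra.
  rewrite mulf_eq0 invr_eq0 (negbTE s_neq0) orbF expf_eq0/=.
  by rewrite mulf_eq0 (negbTE r0) => /eqP.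
have [U1 [V1 [D1 [UU1 VV1 D1ge] B1E]]] := IHn (@drsubmx _ 1 n 1 n B).
pose U2 : 'M[R]_(1 + n) := block_mx 1%:M 0 0 U1.
pose V2 : 'M[R]_(1 + n) := block_mx 1%:M 0 0 V1.
pose D2 : 'rV[R]_(1 + n) := row_mx r%:M D1.
have blkorth (W : 'M[R]_n) : W *m W^T = 1%:M ->
    (block_mx 1%:M 0 0 W : 'M[R]_(1 + n)) *m (block_mx 1%:M 0 0 W)^T = 1%:M.
  move=> WW; rewrite tr_block_mx mulmx_block !trmx0 !mulmx0 !mul0mx trmx1 mulmx1.
  by rewrite !addr0 add0r WW -scalar_mx_block.
have BdefE : B = U *m A *m V^T by [].
have l0 : @lshift 1 n 0 = ord0 :> 'I_n.+1 by apply/val_inj.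
clearbody B.
have BB : (B : 'M[R]_(1 + n)) = U2^T *m diag_mx D2 *m V2.
  rewrite -[LHS](@submxK _ 1 n 1 n) /D2 diag_mx_row /U2 /V2 tr_block_mx !mulmx_block.
  do !rewrite ?trmx0 ?mulmx0 ?mul0mx ?trmx1 ?addr0 ?add0r ?mulmx1 ?mul1mx.
  congr block_mx => //.
  - apply/matrixP => i j; rewrite !ord1 !mxE/= l0 B0j.
    by rewrite !mulr1n ?eqxx mulr1.
  - by apply/matrixP => i j; rewrite !ord1 !mxE/= l0 B0j -l0 mulr0.
  - by apply/matrixP => i j; rewrite !ord1 !mxE/= l0 Bi0.
exists (U2 *m U : 'M[R]_n.+1), (V2 *m V : 'M[R]_n.+1), (D2 : 'rV[R]_n.+1); first split.
- by rewrite trmx_mul mulmxA -(mulmxA U2 U) UU mulmx1 blkorth.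
- by rewrite trmx_mul mulmxA -(mulmxA V2 V) VV mulmx1 blkorth.
- move=> i; rewrite /D2 mxE; case: fintype.split => j; last exact: D1ge.
  by rewrite (ord1 j) mxE mulr1n sqrtr_ge0.
- have -> : A = U^T *m B *m V by rewrite BdefE !mulmxA UU' mul1mx -mulmxA VV' mulmx1.
  by rewrite BB trmx_mul !mulmxA.
Qed.

End SVD.

(** * Inscribed ellipsoids and cutting planes *)

Section InscribedEllipsoid.
Variables (R : realType) (d : nat).
Implicit Types (a c g : 'rV[R]_d) (A : 'M[R]_d) (b : R).

Lemma mul_rV_diag (y D : 'rV[R]_d) i : (y *m diag_mx D) ord0 i = y ord0 i * D ord0 i.
Proof. by rewrite mul_mx_diag mxE. Qed.

Lemma dotp_diag (y z D : 'rV[R]_d) :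
  dotp (y *m diag_mx D) z = \sum_i D ord0 i * (y ord0 i * z ord0 i).
Proof. by apply: eq_bigr => i _; rewrite mul_rV_diag; ring. Qed.

Lemma mul_rV_tr (v w : 'rV[R]_d) : v *m w^T = (dotp v w)%:M.
Proof. by apply/matrixP => i j; rewrite !ord1 [RHS]mxE/= mulr1n dotp_mx. Qed.

(* In an orthonormal basis starting with v / |v| the matrix is diagonal. *)
Lemma det_rank1_update (v : 'rV[R]_d) b :
  \det (1%:M + b *: (v^T *m v)) = 1 + b * dotp v v.
Proof.
have [->|v0] := eqVneq v 0.
  by rewrite mulmx0 scaler0 addr0 det1 dotp0l mulr0 addr0.
case: d v v0 => [|n] v v0; first by rewrite (thinmx0 v) eqxx in v0.
have e0 : enorm v != 0 by rewrite enorm_eq0.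
have [|U UU U0] := @orthogonal_with_row0 R n ((enorm v)^-1 *: v).
  by rewrite dotpZl dotpZr -sqr_enorm mulrA -invfM -expr2 mulVf// expf_neq0.
have vE : v = enorm v *: (delta_mx ord0 ord0 *m U).
  by rewrite -rowE U0 scalerA mulfV// scale1r.
have -> : v^T *m v = dotp v v *: (U^T *m (delta_mx ord0 ord0) *m U).
  rewrite -sqr_enorm [in LHS]vE; move: (enorm v) => w.
  have trZ k (x : 'rV[R]_n.+1) : (k *: x)^T = k *: x^T.
    by apply/matrixP => i j; rewrite !mxE.
  rewrite trZ -scalemxAl -scalemxAr scalerA -expr2.
  rewrite trmx_mul trmx_delta -!mulmxA; congr (_ *: (_ *m _)).
  by rewrite mulmxA mul_delta_mx.
have -> : 1%:M + b *: (dotp v v *: (U^T *m delta_mx ord0 ord0 *m U)) =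
    U^T *m diag_mx (\row_j (1 + (b * dotp v v) * (j == ord0)%:R)) *m U.
  rewrite scalerA (_ : diag_mx _ = 1%:M + (b * dotp v v) *: delta_mx ord0 ord0).
    by rewrite mulmxDr mulmxDl mulmx1 -scalemxAr -scalemxAl (mulmx1C UU).
  apply/matrixP => i j; rewrite !mxE; have [->|ij] := eqVneq i j.
    by rewrite !mulr1n andbb.
  rewrite !mulr0n add0r; case: (eqVneq i ord0) => [i0|_]; last by rewrite mulr0.
  by rewrite -i0 eq_sym (negbTE ij) mulr0.
rewrite !det_mulmx det_tr mulrAC -expr2.
rewrite -[_ ^+ 2]real_normK ?num_real// det_orthogonal// expr1n mul1r det_diag.
rewrite (bigD1 ord0)//= mxE eqxx mulr1 big1 ?mulr1// => i i0.
by rewrite mxE (negbTE i0) mulr0 addr0.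
Qed.

(* The ellipsoid c + {uA^T : |u| <= 1} lies in the half-space {x : <a,x> <= b}. *)
Definition fits a b c A := dotp a c + enorm (a *m A) <= b.

(** Here p and q + s are the support values of the two ellipsoids in one direction, and s / 2 + Y
    that of the new one, all relative to the first centre. If p is the larger of the two, then (p -
    s/2)^2 = p (p - s) + s^2/4 >= p q + s^2/4; the other case is symmetric. *)
Lemma hull_support (p q s Y : R) : 0 <= p -> 0 <= q -> 0 <= Y ->
  Y ^+ 2 <= p * q + s ^+ 2 / 4 -> (s / 2 + Y <= p) || (s / 2 + Y <= q + s).
Proof.
move=> p0 q0 Y0 hY; have [ps|ps] := leP (q + s) p; apply/orP; [left|right].
  have ps2 : 0 <= p - s / 2 by lra.
  suff : Y <= p - s / 2 by lra.
  by rewrite -ler_sqr ?nnegrE//; nra.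
have ps2 : 0 <= q + s / 2 by lra.
suff : Y <= q + s / 2 by lra.
by rewrite -ler_sqr ?nnegrE//; nra.
Qed.

(* Everything is diagonalised by the singular value decomposition of
   A0^-1 A1; the last ellipsoid comes from the geometric mean of the two
   semi-axes matrices, elongated in the direction c1 - c0. *)
Lemma ellipsoid_combinations c0 A0 c1 A1 : \det A0 != 0 -> \det A1 != 0 ->
  exists (D : 'rV[R]_d) (n : R),
  [/\ forall i, 0 < D ord0 i, 0 <= n, `|\det A1| = `|\det A0| * \prod_i D ord0 i,
     (forall g t, g != 0 -> fits g (dotp g c0) c1 A1 ->
       (forall i, t <= D ord0 i) -> t <= n) &
     (exists2 A2, `|\det A2| = `|\det A0| * \prod_i ((1 + D ord0 i) / 2) &
        forall a b, fits a b c0 A0 -> fits a b c1 A1 ->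
          fits a b (2^-1 *: (c0 + c1)) A2) /\
     (exists2 A3, `|\det A3| ^+ 2 = `|\det A0| ^+ 2 * (\prod_i D ord0 i) *
                    (1 + n / (8 * (1 + n))) ^+ 2 &
        forall a b, fits a b c0 A0 -> fits a b c1 A1 ->
          fits a b (2^-1 *: (c0 + c1)) A3)].
Proof.
move=> dA0 dA1.
have uA0 : A0 \in unitmx by rewrite unitmxE unitfE.
have [U [V [D [UU VV D0] MD]]] := svd (invmx A0 *m A1).
(* The map u -> u W^T sends the unit ball to the first ellipsoid and the axis-parallel one with
   semi-axes [D] to the second, up to translation. *)
pose W := A0 *m U^T.
have A1E : A1 = W *m diag_mx D *m V.
  by rewrite /W -!mulmxA (mulmxA U^T) -MD mulKVmx.
have UU' := mulmx1C UU.
have UUT : U^T *m (U^T)^T = 1%:M by rewrite trmxK UU'.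
have dW : `|\det W| = `|\det A0|.
  by rewrite det_mulmx normrM (det_orthogonal UUT) mulr1.
have pE a : enorm (a *m A0) = enorm (a *m W).
  by rewrite /W mulmxA (enorm_orthogonal _ UUT).
clearbody W; have uW : W \in unitmx by rewrite unitmxE unitfE -normr_eq0 dW normr_eq0.
have prodD0 : 0 <= \prod_i D ord0 i by apply: prodr_ge0.
have dA1E : `|\det A1| = `|\det A0| * \prod_i D ord0 i.
  by rewrite A1E !det_mulmx !normrM dW (det_orthogonal VV) mulr1 det_diag (ger0_norm prodD0).
have Dgt i : 0 < D ord0 i.
  rewrite lt0r D0 andbT; apply: contra_neq dA1 => Di.
  by apply/eqP; rewrite -normr_eq0 dA1E (bigD1 i)//= Di mul0r mulr0.
pose e := c1 - c0.
pose z := e *m invmx W^T.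
have eE : e = z *m W^T by rewrite mulmxKV// unitmx_tr.
pose rD := \row_i Num.sqrt (D ord0 i) : 'rV[R]_d.
pose v := \row_i (z ord0 i / Num.sqrt (D ord0 i)) : 'rV[R]_d.
(* With [z] the displacement of the centres in these coordinates, this is z D^-1 z^T. *)
pose n := dotp v v.
have n0 : 0 <= n := dotp_ge0 _.
have nE : n = \sum_i (z ord0 i ^+ 2 / D ord0 i).
  apply: eq_bigr => i _; rewrite !mxE -expr2 exprMn exprVn sqr_sqrtr//.
have sE a : dotp a e = dotp (a *m W) z by rewrite eE dotp_mulmx.
have qE a : enorm (a *m A1) = enorm (a *m W *m diag_mx D).
  by rewrite A1E !mulmxA (enorm_orthogonal _ VV).
have c1E a : dotp a c1 = dotp a c0 + dotp a e by rewrite /e dotpBr; ring.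
have cE a : dotp a (2^-1 *: (c0 + c1)) = dotp a c0 + dotp a e / 2.
  by rewrite dotpZr dotpDr c1E; field.
have sumyz a : dotp a e = \sum_i (a *m W) ord0 i * z ord0 i by rewrite sE.
exists D, n; split=> //; last split.
- move=> g t g0; rewrite /fits c1E qE -addrA gerDl => hg Dt.
  set y := g *m W in hg; have y0 : y != 0.
    apply: contra_neq g0 => y0; have : y *m invmx W = 0 by rewrite y0 mul0mx.
    by rewrite mulmxK.
  have [t0|t0] := leP t 0; first exact: le_trans t0 n0.
  pose yr := y *m diag_mx rD.
  have yrv : dotp yr v = dotp g e.
    rewrite sumyz; apply: eq_bigr => i _; rewrite mul_rV_diag !mxE.
    have : Num.sqrt (D ord0 i) != 0 by rewrite gt_eqF// sqrtr_gt0.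
    by move=> ?; rewrite -/y; field.
  have yryr : dotp yr yr = \sum_i D ord0 i * (y ord0 i ^+ 2).
    apply: eq_bigr => i _; rewrite mul_rV_diag !mxE -expr2 exprMn sqr_sqrtr//.
    by rewrite mulrC.
  have yrgt : 0 < dotp yr yr.
    rewrite lt0r dotp_ge0 andbT dotp_eq0; apply: contra_neq y0 => yr0.
    apply/rowP => i; have := congr1 (fun M : 'rV_d => M ord0 i) yr0.
    rewrite mul_rV_diag !mxE => /eqP; rewrite mulf_eq0 sqrtr_eq0 leNgt Dgt orbF.
    by move/eqP.
  (* The cut says that |yD| <= - <g,e>, where <g,e> = <yr,v> and |yr|^2 = y D y^T. Cauchy-Schwarz
     gives |yD|^2 <= n |yr|^2, while D >= t gives |yD|^2 >= t |yr|^2. *)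
  have CS := dotp_CS yr v; rewrite yrv in CS.
  have yD : dotp yr yr * t <= enorm (y *m diag_mx D) ^+ 2.
    rewrite sqr_enorm yryr mulr_suml; apply: ler_sum => i _.
    rewrite mul_rV_diag -expr2 exprMn.
    have := Dt i; have := sqr_ge0 (y ord0 i); have := D0 i => a1 a2 a3.
    by rewrite mulrC mulrA (mulrC t) mulrC ler_wpM2l// expr2 ler_wpM2l.
  have h2 : enorm (y *m diag_mx D) ^+ 2 <= dotp g e ^+ 2.
    by rewrite -[X in _ <= X]sqrrN ler_sqr ?nnegrE ?enorm_ge0//;
      have := enorm_ge0 (y *m diag_mx D); lra.
  rewrite -(ler_pM2l yrgt); exact: le_trans yD (le_trans h2 CS).
- exists (W *m diag_mx (\row_i ((1 + D ord0 i) / 2))).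
    rewrite det_mulmx normrM dW det_diag; congr (_ * _).
    rewrite ger0_norm; first by apply: eq_bigr => i _; rewrite mxE.
    by apply: prodr_ge0 => i _; rewrite mxE divr_ge0// addr_ge0.
  move=> a b; rewrite /fits cE c1E pE qE mulmxA; set y := a *m W.
  have -> : y *m diag_mx (\row_i ((1 + D ord0 i) / 2)) =
      2^-1 *: y + 2^-1 *: (y *m diag_mx D).
    by apply/rowP => i; rewrite !mul_mx_diag ![in LHS]mxE ![in RHS]mxE; field.
  have := enormD (2^-1 *: y) (2^-1 *: (y *m diag_mx D)).
  rewrite !enormZ ger0_norm ?invr_ge0//; lra.
(* The shape D + z^T z / 4 would call for the square root of 1 + v^T v / 4. The explicit factor 1 +
   be v^T v replaces it: its square is no larger, because 2 be + be^2 n <= 1/4. *)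
- pose be := (8 * (1 + n))^-1.
  have be0 : 0 <= be by rewrite invr_ge0; lra.
  exists (W *m diag_mx rD *m (1%:M + be *: (v^T *m v))).
    rewrite !det_mulmx !normrM dW det_rank1_update -/n !exprMn; congr (_ * _ * _).
      rewrite det_diag ger0_norm; last by apply: prodr_ge0 => i _; rewrite mxE sqrtr_ge0.
      by rewrite -prodrXl; apply: eq_bigr => i _; rewrite mxE sqr_sqrtr.
    by rewrite (mulrC n) ger0_norm// addr_ge0// mulr_ge0.
  move=> a b; rewrite /fits cE c1E pE qE !mulmxA; set y := a *m W.
  set s := dotp a e; set p := enorm y; set q := enorm (y *m diag_mx D).
  set Y := enorm _.
  have hull := @hull_support p q s Y (enorm_ge0 _) (enorm_ge0 _) (enorm_ge0 _).
  move=> h0 h1; suff : (s / 2 + Y <= p) || (s / 2 + Y <= q + s) by case/orP; lra.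
  apply: hull; rewrite /Y sqr_enorm mulmxDr mulmx1 -scalemxAr mulmxA mul_rV_tr.
  set yr := y *m diag_mx rD.
  have yrv : dotp yr v = s.
    rewrite /s sumyz; apply: eq_bigr => i _; rewrite mul_rV_diag !mxE.
    have : Num.sqrt (D ord0 i) != 0 by rewrite gt_eqF// sqrtr_gt0.
    by move=> ?; rewrite -/y; field.
  rewrite yrv mul_scalar_mx dotp_sqrD !dotpZr !dotpZl yrv -/n.
  have yryr : dotp yr yr <= p * q.
    apply: le_trans (dotp_enorm y (y *m diag_mx D)).
    rewrite dotpC dotp_diag; apply: ler_sum => i _; rewrite mul_rV_diag !mxE.
    rewrite mulrACA -[X in _ * X]expr2 sqr_sqrtr//.
    by rewrite mulrC.
  have bn : 2 * be + be ^+ 2 * n <= 1 / 4.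
    have n1 : 0 < 1 + n by lra.
    rewrite /be -subr_ge0.
    have -> : 1 / 4 - (2 * (8 * (1 + n))^-1 + (8 * (1 + n))^-1 ^+ 2 * n) =
       (16 * (1 + n) ^+ 2 - 16 * (1 + n) - n) / (64 * (1 + n) ^+ 2).
      by field; apply/eqP; lra.
    by rewrite divr_ge0//; nra.
  have := sqr_ge0 s => ss; have := ler_wpM2l ss bn; lra.
Qed.

End InscribedEllipsoid.

(** * Volume decrease under cuts through the centre *)

Section CuttingPlane.
Variables (R : realType) (d : nat) (rad : R).
Hypothesis rad0 : 0 <= rad.
Implicit Types (a c g x : 'rV[R]_d) (A : 'M[R]_d) (cs : seq ('rV[R]_d * R)).

(** The ball enters through all its supporting half-spaces, so that it and the cuts are handled by
    the same predicate. Degenerate ellipsoids are allowed. *)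
Definition inscribed cs c A :=
  (forall a, fits a (rad * enorm a) c A) /\
  (forall h, h \in cs -> fits h.1 h.2 c A).

Lemma inscribed_enorm cs c A : inscribed cs c A -> enorm c <= rad.
Proof.
move=> [/(_ c) + _]; rewrite /fits -sqr_enorm => h.
have [->|c0] := eqVneq c 0; first by rewrite enorm0.
have cp : 0 < enorm c by rewrite enorm_gt0.
by rewrite -(ler_pM2r cp); have := enorm_ge0 (c *m A); lra.
Qed.

(** The supports in the directions +e_i and -e_i add up to |e_i A| <= rad, which bounds every entry;
    the Leibniz formula has d! <= d^d terms. This crude bound suffices, as only its logarithm
    matters. *)
Lemma det_inscribed_le cs c A : inscribed cs c A -> `|\det A| <= (d%:R * rad) ^+ d.
Proof.
move=> [hA _].
have Ale i j : `|A i j| <= rad.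
  have e1 := hA (delta_mx ord0 i); have e2 := hA (- delta_mx ord0 i).
  move: e1 e2; rewrite /fits mulNmx dotpNl !enormN enorm_delta mulr1 => e1 e2.
  have := coord_le_enorm (delta_mx ord0 i *m A) j.
  by rewrite -rowE mxE; rewrite -rowE in e1 e2; lra.
have fact_exp n : (n`! <= n ^ n)%N.
  elim: n => // n IH; rewrite factS expnS leq_mul2l/=.
  by case: n IH => // n IH; apply: leq_trans IH _; rewrite leq_exp2r.
rewrite /determinant; apply: le_trans (ler_norm_sum _ _ _) _.
apply: (@le_trans _ _ (\sum_(s : 'S_d) rad ^+ d)).
  apply: ler_sum => s _; rewrite normrM normrX normrN1 expr1n mul1r normr_prod.
  apply: (@le_trans _ _ (\prod_(i < d) rad)); last by rewrite prodr_const card_ord.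
  by apply: ler_prod => i _; rewrite normr_ge0 Ale.
rewrite sumr_const card_Sn exprMn -[leLHS]mulr_natl ler_wpM2r ?exprn_ge0//.
by rewrite -natrX ler_nat.
Qed.

(** Each factor satisfies ((1 + D_i) / 2)^2 >= D_i, and the factor of [j] gains 9/8, with equality
    at D_j = 1/2. *)
Lemma sqr_prod_mean_ge (D : 'rV[R]_d) j : (forall i, 0 < D ord0 i) ->
  D ord0 j < 1 / 2 ->
  9 / 8 * \prod_i D ord0 i <= (\prod_i ((1 + D ord0 i) / 2)) ^+ 2.
Proof.
move=> D0 Dj; rewrite -prodrXl (bigD1 j)//= [leRHS](bigD1 j)//= mulrA.
have le1 : \prod_(i < d | i != j) D ord0 i <=
    \prod_(i < d | i != j) ((1 + D ord0 i) / 2) ^+ 2.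
  by apply: ler_prod => i _; rewrite ltW//=; have := sqr_ge0 (D ord0 i - 1); nra.
have := D0 j => Dj0.
apply: ler_pM => //; [by nra| |by nra].
by apply: prodr_ge0 => i _; exact: ltW.
Qed.

(* 19/20 is larger than (101/100)^2 / (9/8) and (101/100)^2 / (25/24)^2, the
   bounds given by the two combinations, according to whether some D_i < 1/2. *)
Lemma cut_shrinks cs c0 A0 g c1 A1 :
  (forall c A, inscribed cs c A -> `|\det A| <= 101 / 100 * `|\det A0|) ->
  inscribed cs c0 A0 -> \det A0 != 0 -> g != 0 ->
  inscribed ((g, dotp g c0) :: cs) c1 A1 -> `|\det A1| <= 19 / 20 * `|\det A0|.
Proof.
move=> max0 ins0 dA0 g0 ins1.
have dA0p : 0 < `|\det A0| by rewrite normr_gt0.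
have [->|dA1] := eqVneq (\det A1) 0; first by rewrite normr0; lra.
have fitg : fits g (dotp g c0) c1 A1 by apply: (ins1.2 (_, _)); rewrite mem_head.
have ins1' : inscribed cs c1 A1.
  by split=> [|h hcs]; [exact: ins1.1|apply: ins1.2; rewrite inE hcs orbT].
have [D [n [D0 n0 dA1E cutn [[A2 dA2 fit2] [A3 dA3 fit3]]]]] :=
  ellipsoid_combinations c0 c1 dA0 dA1.
have ins2 : inscribed cs (2^-1 *: (c0 + c1)) A2.
  split=> [a|h hcs]; apply: fit2; by [apply: ins0.1|apply: ins1'.1|apply: ins0.2|apply: ins1'.2].
have ins3 : inscribed cs (2^-1 *: (c0 + c1)) A3.
  split=> [a|h hcs]; apply: fit3; by [apply: ins0.1|apply: ins1'.1|apply: ins0.2|apply: ins1'.2].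
have {ins2 fit2} := max0 _ _ ins2; have {ins3 fit3} := max0 _ _ ins3.
rewrite -ler_sqr ?nnegrE ?mulr_ge0// dA3 exprMn [101 / 100 * _]mulrC dA2 ler_pM2l// => h3 h2.
rewrite dA1E mulrC ler_pM2r//; set P := \prod_i D ord0 i in h3 *.
have P0 : 0 < P by apply: prodr_gt0.
have {}h3 : P * (1 + n / (8 * (1 + n))) ^+ 2 <= (101 / 100) ^+ 2.
  by rewrite -(ler_pM2l (exprn_gt0 2 dA0p)) mulrA [leRHS]mulrC.
have [j /andP[_ Dj]|Dge] := pickP (fun j => true && (D ord0 j < 1 / 2)).
  have := sqr_prod_mean_ge D0 Dj; rewrite -/P => h.
  have : (\prod_i ((1 + D ord0 i) / 2)) ^+ 2 <= (101 / 100) ^+ 2.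
    rewrite ler_sqr ?nnegrE//; apply: prodr_ge0 => i _.
    by have := D0 i; lra.
  lra.
(* No semi-axis is short, so lying beyond the cut keeps the second centre away from the first. *)
have n2 : 1 / 2 <= n.
  by apply: (cutn g) => // i; rewrite leNgt; have := Dge i => /= ->.
have q : 25 / 24 <= 1 + n / (8 * (1 + n)).
  rewrite -subr_ge0 (_ : _ - _ = (2 * n - 1) / (24 * (1 + n))).
    by rewrite divr_ge0; lra.
  by field; apply/eqP; lra.
have q2 : (25 / 24) ^+ 2 <= (1 + n / (8 * (1 + n))) ^+ 2.
  by rewrite ler_sqr ?nnegrE; lra.
have := ler_wpM2l (ltW P0) q2; lra.
Qed.

(** The second clause refers to an arbitrary bound [v] instead of a maximal volume: it can be
    iterated along the cuts, and it makes sense when all inscribed ellipsoids are degenerate. *)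
Definition good_center cs x := enorm x <= rad /\
  forall g v, g != 0 -> (forall c A, inscribed cs c A -> `|\det A| <= v) ->
    forall c A, inscribed ((g, dotp g x) :: cs) c A -> `|\det A| <= 19 / 20 * v.

Lemma exists_good_center cs : exists x, good_center cs x.
Proof.
pose S := [set `|\det p.2| | p in [set p | inscribed cs p.1 p.2]].
have [[[c A] insA /= dA]|noA] := pselect (exists2 p, inscribed cs p.1 p.2 & \det p.2 != 0); last first.
  exists 0; split; first by rewrite enorm0.
  move=> g v g0 hv c A insA; have insA' : inscribed cs c A.
    by split=> [|h hcs]; [exact: insA.1|apply: insA.2; rewrite inE hcs orbT].
  have dA : \det A = 0.
    by apply/eqP/negPn/negP => dA; apply: noA; exists (c, A).
  have := hv _ _ insA'; rewrite dA normr0 => v0; lra.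
have hS : has_sup S.
  split; first by exists `|\det A|, (c, A).
  by exists ((d%:R * rad) ^+ d) => _ [p /det_inscribed_le ? <-].
have Sle c' A' : inscribed cs c' A' -> `|\det A'| <= sup S.
  by move=> ins; apply: ub_le_sup; [exact: hS.2|exists (c', A')].
have S0 : 0 < sup S by apply: lt_le_trans (Sle _ _ insA); rewrite normr_gt0.
(* A volume above sup S - sup S / 101 = (100/101) sup S is maximal up to the factor 101/100 required
   by [cut_shrinks]; the supremum need not be attained. *)
have [|_ [[c0 A0] /= ins0 <-] supA0] := @sup_adherent _ S (sup S / 101) _ hS; first lra.
exists c0; split; first exact: inscribed_enorm ins0.
move=> g v g0 hv c' A' ins'.
have dA0 : \det A0 != 0 by rewrite -normr_gt0; lra.
apply: (@le_trans _ _ (19 / 20 * `|\det A0|)); last by have := hv _ _ ins0; lra.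
apply: cut_shrinks ins' => // c2 A2 ins2.
have := Sle _ _ ins2; lra.
Qed.

Definition ellipsoid_center cs := xget 0 [set x | good_center cs x].

Lemma ellipsoid_centerP cs : good_center cs (ellipsoid_center cs).
Proof. by have [x gx] := exists_good_center cs; apply: xgetPex; exists x. Qed.

(* [gs] lists the answers to the queries at the successive centres, latest first. *)
Fixpoint cuts (gs : seq 'rV[R]_d) : seq ('rV[R]_d * R) :=
  match gs with
  | [::] => [::]
  | g :: gs' => (g, dotp g (ellipsoid_center (cuts gs'))) :: cuts gs'
  end.

Lemma cuts_det_le gs : all (fun g => g != 0) gs -> forall c A,
  inscribed (cuts gs) c A -> `|\det A| <= (19 / 20) ^+ size gs * (d%:R * rad) ^+ d.
Proof.
elim: gs => [_ c A /det_inscribed_le|g gs IH /= /andP[g0 gs0] c A ins].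
  by rewrite expr0 mul1r.
by rewrite exprS -mulrA; apply: (ellipsoid_centerP (cuts gs)).2 ins => //; exact: IH.
Qed.

Lemma mem_cuts1 gs h : h \in cuts gs -> h.1 \in gs.
Proof.
elim: gs => //= g gs IH; rewrite !inE => /orP[/eqP->|/IH ->]; first by rewrite eqxx.
by rewrite orbT.
Qed.

Lemma mem_cuts gs g : g \in gs -> exists2 h, h \in cuts gs & h.1 = g.
Proof.
elim: gs => //= g' gs IH; rewrite inE => /orP[/eqP->|/IH[h hc hg]].
  by eexists; first exact: mem_head.
by exists h => //; rewrite inE hc orbT.
Qed.

(** A point at depth e inside every cut is the centre of a ball of radius r that lies in the
    remaining region, as r |g| <= e. Its volume obeys the bound that has shrunk with every cut. *)
Lemma cutting_plane gs (G e r : R) x : 0 < e ->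
  0 < r -> r * 2 <= rad -> r * G <= e ->
  (forall g, g \in gs -> enorm g <= G) -> enorm x * 2 <= rad ->
  (forall h, h \in cuts gs -> dotp h.1 x <= h.2 - e) ->
  r ^+ d <= (19 / 20) ^+ size gs * (d%:R * rad) ^+ d.
Proof.
move=> e0 r0 rrad rG gG xrad cut.
(* A zero answer would give the cut 0 <= 0, inside which no point has positive depth. *)
have gs0 : all (fun g => g != 0) gs.
  apply/allP => g ggs; apply/eqP => g0.
  have cst gs' h : h \in cuts gs' -> h.1 = 0 -> h.2 = 0.
    elim: gs' => //= g' gs' IH; rewrite inE => /orP[/eqP-> /= ->|]; last exact: IH.
    by rewrite dotp0l.
  have [h hc hg] := mem_cuts ggs; have := cut h hc.
  by rewrite hg g0 dotp0l (cst _ _ hc) ?hg//; lra.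
have ins : inscribed (cuts gs) x r%:M.
  split=> [a|h hc]; rewrite /fits mul_mx_scalar enormZ gtr0_norm//.
    have := dotp_enorm a x; have := enorm_ge0 a => a0 h.
    have : enorm a * (enorm x * 2) <= enorm a * rad by rewrite ler_wpM2l.
    have : enorm a * (r * 2) <= enorm a * rad by rewrite ler_wpM2l.
    lra.
  have := cut h hc; have := gG _ (mem_cuts1 hc) => h1 h2.
  have : r * enorm h.1 <= r * G by rewrite ler_pM2l.
  lra.
by have := cuts_det_le gs0 ins; rewrite det_scalar ger0_norm ?exprn_ge0// ltW.
Qed.

End CuttingPlane.

(** * Averaging certificates *)

Section Certificate.
Variables (R : realType) (d : nat).

Definition in_simplex (T : nat) (l : 'rV[R]_T) :=
  (forall i, 0 <= l ord0 i) /\ \sum_i l ord0 i = 1.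

Lemma simplex_compact (T : nat) : compact [set l : 'rV[R]_T | in_simplex l].
Proof.
apply: (@coord_bounded_compact _ _ _ 1) => [|l [l0 l1] i].
  have -> : [set l : 'rV[R]_T | in_simplex l] =
      (\bigcap_i [set l | 0 <= l ord0 i]) `&` [set l | \sum_i l ord0 i = 1].
    by apply/seteqP; split => l [] h1 h2; split => // i; [move=> _|]; exact: h1.
  apply: closedI.
    apply: closed_bigI => i _.
    exact: (continuous_closedP _).1 (@coord_continuous _ _ _ ord0 i) _ (@closed_ge R 0).
  have cs : continuous (fun l : 'rV[R]_T => \sum_i l ord0 i).
    by apply: continuous_sum => i; exact: coord_continuous.
  exact: (continuous_closedP _).1 cs _ (@closed_eq R 1).
rewrite ger0_norm// -l1 (bigD1 i)//= lerDl; exact: sumr_ge0.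
Qed.

Lemma sqrt_tangent (B B' : R) : 0 < B -> 0 <= B' ->
  Num.sqrt B' <= Num.sqrt B + (B' - B) / (2 * Num.sqrt B).
Proof.
move=> B0 B'0; have r0 : 0 < Num.sqrt B by rewrite sqrtr_gt0.
rewrite -{2}(sqr_sqrtr (ltW B0)) -{2}(sqr_sqrtr B'0).
set r := Num.sqrt B in r0 *; set q := Num.sqrt B'.
rewrite -subr_ge0 (_ : _ - _ = (q - r) ^+ 2 / (2 * r)).
  by rewrite divr_ge0 ?sqr_ge0// mulr_ge0// ltW.
by field; rewrite gt_eqF.
Qed.

Lemma linear_term_ge0 (a b : R) : (forall t, 0 < t -> t <= 1 -> 0 <= t * a + t ^+ 2 * b) -> 0 <= a.
Proof.
move=> h; rewrite leNgt; apply/negP => a0.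
(* Small enough for the quadratic term to be at most half of the linear one in absolute value. *)
pose t := Num.min 1 (- a / (2 * (`|b| + 1))).
have b1 : 0 < 2 * (`|b| + 1) by have := normr_ge0 b; lra.
have t0 : 0 < t by rewrite lt_min ltr01/= divr_gt0// oppr_gt0.
have t1 : t <= 1 by rewrite ge_min lexx.
have tb : t * (2 * (`|b| + 1)) <= - a by rewrite -ler_pdivlMr// ge_min lexx orbT.
have := h t t0 t1; have := ler_norm b => bb.
have : t * (t * b) <= t * (t * (`|b| + 1)).
  by rewrite ler_pM2l// ler_pM2l//; lra.
have : t * (t * (2 * (`|b| + 1))) <= t * (- a) by rewrite ler_pM2l.
have : t * a < 0 by rewrite nmulr_llt0.
rewrite expr2; lra.
Qed.

(* Minimise over the simplex the (smoothed) dual of the problem of finding y in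
   the ball with <g_b, y - x_b> <= - c for all b: by first-order optimality,
   y = - rad G / sqrt(|G|^2 + e^2) with G = sum_b l_b g_b would be a solution if
   the minimum were more than rad e. *)
Lemma certificate (T : nat) (g x : 'I_T.+1 -> 'rV[R]_d) (rad c e : R) :
  0 <= rad -> 0 < e ->
  (forall y, enorm y <= rad -> exists b, dotp (g b) (x b - y) < c) ->
  exists2 l : 'rV[R]_T.+1, in_simplex l &
    forall y, enorm y <= rad ->
      \sum_b l ord0 b * dotp (g b) (x b - y) <= c + rad * e.
Proof.
move=> rad0 e0 noy.
pose M := \matrix_b g b.
have lM (l : 'rV[R]_T.+1) : l *m M = \sum_b l ord0 b *: g b.
  by rewrite mulmx_sum_row; apply: eq_bigr => b _; rewrite rowK.
pose be b := dotp (g b) (x b) - c.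
(* The summand e^2 keeps the root differentiable where the combined gradient vanishes. *)
pose S (l : 'rV[R]_T.+1) := dotp (l *m M) (l *m M) + e ^+ 2.
pose phi (l : 'rV[R]_T.+1) := \sum_b l ord0 b * be b + rad * Num.sqrt (S l).
have e20 : 0 < e ^+ 2 by rewrite exprn_gt0.
have S0 l : 0 < S l by have := dotp_ge0 (l *m M); rewrite /S; lra.
have cphi : continuous phi.
  have c1 : continuous (fun l : 'rV[R]_T.+1 => \sum_b l ord0 b * be b).
    apply: continuous_sum => b; apply: continuousM_fun; last exact: cst_continuous.
    exact: coord_continuous.
  have c2 : continuous (fun l => rad * Num.sqrt (S l)).
    apply: continuousM_fun; first exact: cst_continuous.
    move=> l; apply: continuous_comp; last exact: sqrt_continuous.
    move: l; apply: continuousD_fun; last exact: cst_continuous.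
    exact: continuous_dotp_mulmx.
  exact: continuousD_fun.
have ne : [set l : 'rV[R]_T.+1 | in_simplex l] !=set0.
  exists (delta_mx ord0 ord0); split => [i|]; first by rewrite mxE; case: (_ && _).
  rewrite (bigD1 ord0)//= mxE !eqxx big1 ?addr0// => i i0.
  by rewrite mxE (negbTE i0) andbF.
have [l lS lmin] := EVT_min_rV ne (@simplex_compact T.+1) (continuous_subspaceT cphi).
move: lS; rewrite inE => -[l0 l1].
exists l => //; set G := l *m M; pose rho := Num.sqrt (S l).
have rho0 : 0 < rho by rewrite sqrtr_gt0.
have rho2 : rho ^+ 2 = dotp G G + e ^+ 2 by rewrite sqr_sqrtr// ltW.
(* First-order optimality on moving from [l] towards the vertex [b] of the simplex; concavity of the
   root makes the increment explicit. *)
have opt b : 0 <= (be b - \sum_b l ord0 b * be b) + rad * dotp G (g b - G) / rho.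
  apply: (@linear_term_ge0 _ (rad * dotp (g b - G) (g b - G) / (2 * rho))) => t t0 t1.
  pose l' := l + t *: (delta_mx ord0 b - l).
  have l'E i : l' ord0 i = (1 - t) * l ord0 i + t * (b == i)%:R.
    by rewrite !mxE eqxx/= eq_sym; ring.
  have l'S : in_simplex l'.
    split=> [i|]; first by rewrite l'E addr_ge0// mulr_ge0//; lra.
    rewrite (eq_bigr _ (fun i _ => l'E i)) big_split/= -!mulr_sumr l1.
    have -> : \sum_(i < T.+1) ((b == i)%:R : R) = 1.
      by rewrite (bigD1 b)//= eqxx big1 ?addr0// => i ib; rewrite eq_sym (negbTE ib).
    by ring.
  have := lmin l'; rewrite inE => /(_ l'S).
  have l'M : l' *m M = G + t *: (g b - G).
    by rewrite mulmxDl -scalemxAl mulmxBl -rowE rowK.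
  have SE : S l' - S l = 2 * t * dotp G (g b - G) + t ^+ 2 * dotp (g b - G) (g b - G).
    by rewrite /S l'M (dotp_sqrD G) !dotpZr !dotpZl -/G; ring.
  have sumE : \sum_b l' ord0 b * be b = (1 - t) * \sum_b l ord0 b * be b + t * be b.
    rewrite mulr_sumr [in RHS](_ : be b = \sum_i (b == i)%:R * be i).
      rewrite mulr_sumr -big_split/=; apply: eq_bigr => i _; rewrite l'E; ring.
    rewrite (bigD1 b)//= eqxx mul1r big1 ?addr0// => i ib.
    by rewrite eq_sym (negbTE ib) mul0r.
  have := sqrt_tangent (S0 l) (ltW (S0 l')); rewrite SE -/rho => tang.
  have := ler_wpM2l rad0 tang; rewrite /phi sumE -/rho => h1 h2.
  have h3 : rad * (rho + (2 * t * dotp G (g b - G) + t ^+ 2 * dotp (g b - G) (g b - G)) / (2 * rho)) =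
     rad * rho + t * (rad * dotp G (g b - G) / rho) + t ^+ 2 * (rad * dotp (g b - G) (g b - G) / (2 * rho)).
    by field; rewrite gt_eqF.
  rewrite h3 in h1; lra.
have GG := dotp_ge0 G.
have phil : phi l <= rad * e.
  pose y := - (rad / rho) *: G.
  have Grho : enorm G <= rho by rewrite ler_wsqrtr// lerDl ltW.
  have yrad : enorm y <= rad.
    rewrite enormZ normrN ger0_norm ?divr_ge0 ?(ltW rho0)//.
    by rewrite mulrAC ler_pdivrMr// ler_wpM2l.
  have [b hb] := noy y yrad; have := opt b.
  rewrite dotpBr in hb.
  have dGy : dotp (g b) y = - (rad * dotp G (g b) / rho).
    by rewrite dotpZr (dotpC G); ring.
  have : be b - dotp (g b) y < 0 by rewrite /be; lra.
  rewrite dotpBr dGy /phi -/rho mulrBr mulrBl.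
  (* The price of smoothing: rho - |G|^2 / rho = e^2 / rho <= e. *)
  have radrho : rad * rho <= rad * dotp G G / rho + rad * e.
    have -> : rad * rho = rad * dotp G G / rho + rad * (e ^+ 2 / rho).
      have -> : rad * rho = rad * rho ^+ 2 / rho by field; rewrite gt_eqF.
      by rewrite rho2; field; rewrite gt_eqF.
    rewrite lerD2l ler_wpM2l// ler_pdivrMr// expr2 ler_pM2l//.
    by rewrite -ler_sqr ?nnegrE ?(ltW e0) ?(ltW rho0)// rho2 lerDr.
  lra.
move=> y yrad.
have -> : \sum_b l ord0 b * dotp (g b) (x b - y) = \sum_b l ord0 b * be b + c - dotp G y.
  rewrite -[c]mul1r -l1 mulr_suml /G lM dotp_suml -big_split -sumrB/=.
  by apply: eq_bigr => b _; rewrite dotpBr dotpZl /be; ring.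
have h1 := dotp_enorm_abs G y.
have h2 : enorm G * enorm y <= rho * rad.
  by rewrite ler_pM ?enorm_ge0// ler_wsqrtr// lerDl ltW.
have h3 : - dotp G y <= `|dotp G y| by rewrite -normrN ler_norm.
move: phil; rewrite /phi -/rho; lra.
Qed.

End Certificate.

(** * Independence and concentration *)

Section ProductExpectation.
Local Open Scope ereal_scope.
Context (R : realType) (dW dO : measure_display).
Context (W : measurableType dW) (Omega : measurableType dO).
Context (Pr : probability W R) (P : probability Omega R).

Import HBNNSimple.

(** The passage from indicators to nonnegative functions, by simple functions and monotone
    convergence. The weight [g] will be the product of the other factors. *)
Lemma integral_comp_mul (xi : W -> Omega) (g : W -> R) (c : R) :
  measurable_fun setT xi -> measurable_fun setT g -> (forall w, 0 <= g w)%R ->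
  (0 <= c)%R ->
  (forall B, measurable B -> \int[Pr]_w (\1_B (xi w) * g w)%:E = c%:E * P B) ->
  forall h : Omega -> R, measurable_fun setT h -> (forall x, 0 <= h x)%R ->
  \int[Pr]_w (h (xi w) * g w)%:E = c%:E * \int[P]_x (h x)%:E.
Proof.
move=> mxi mg g0 c0 hB h mh h0.
have mEh : measurable_fun [set: Omega] (EFin \o h : Omega -> \bar R).
  exact/measurable_EFinP.
have Eh0 x : setT x -> 0 <= (EFin \o h) x by move=> _; rewrite lee_fin.
pose f_ := nnsfun_approx measurableT mEh.
have cvgf x : (f_ n x)%:E @[n --> \oo] --> (h x)%:E.
  exact: (cvg_nnsfun_approx measurableT mEh Eh0).
have ndf x m n : (m <= n)%N -> (f_ m x <= f_ n x)%R.
  by move=> mn; exact/lefP/nd_nnsfun_approx.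
have mfxi n : measurable_fun setT (fun w => f_ n (xi w) * g w)%R.
  by apply: measurable_funM => //; apply: measurableT_comp => //; exact: measurable_funTS.
have simple n : \int[Pr]_w (f_ n (xi w) * g w)%:E = c%:E * \int[P]_x (f_ n x)%:E.
  have mpre r : measurable (f_ n @^-1` [set r]) by exact: measurable_sfunP.
  have mind r : measurable_fun setT (fun w => \1_(f_ n @^-1` [set r]) (xi w) * g w)%R.
    by apply: measurable_funM => //; apply: measurableT_comp => //; exact: measurable_indic.
  have ind0 r w : (0 <= r)%R -> 0 <= (r * (\1_(f_ n @^-1` [set r]) (xi w) * g w))%:E.
    by move=> r0; rewrite lee_fin !mulr_ge0.
  have zero r w : ~~ (0 <= r)%R -> (\1_(f_ n @^-1` [set r]) w = 0 :> R)%R.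
    by rewrite -ltNge => r0; rewrite preimage_nnfun0// indic0.
  transitivity (\int[Pr]_w \sum_(r \in range (f_ n))
      (r * (\1_(f_ n @^-1` [set r]) (xi w) * g w))%:E).
    apply: eq_integral => w _; rewrite fsumEFin//; congr EFin.
    rewrite [in LHS]fimfunE !fsbig_finite//= mulr_suml.
    by apply: eq_bigr => r _; rewrite mulrA.
  rewrite ge0_integral_fsum//; last 2 first.
    - by move=> r; exact/measurable_EFinP/measurable_funM.
    - move=> r w _; have [r0|r0] := boolP (0 <= r)%R; first exact: ind0.
      by rewrite zero// mul0r mulr0.
  transitivity (c%:E * \int[P]_x \sum_(r \in range (f_ n)) (r * \1_(f_ n @^-1` [set r]) x)%:E).
    rewrite ge0_integral_fsum//; last 2 first.
      - by move=> r; exact/measurable_EFinP/measurable_funM.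
      - by move=> r x _; rewrite nnfun_muleindic_ge0.
    rewrite ge0_mule_fsumr; last first.
      by move=> r; apply: integral_ge0 => x _; rewrite nnfun_muleindic_ge0.
    apply: eq_fsbigr => r _.
    rewrite integralZl_indic_nnsfun// integral_indic// setIT.
    have [r0|r0] := boolP (0 <= r)%R.
      under eq_integral do rewrite EFinM.
      rewrite ge0_integralZl//; first by rewrite hB// muleCA.
      - exact/measurable_EFinP.
      - by move=> w _; rewrite lee_fin mulr_ge0.
    under eq_integral do rewrite zero// mul0r mulr0.
    by rewrite integral0 (_ : _ @^-1` _ = set0) ?measure0 ?mule0// preimage_nnfun0// ltNge.
  congr (_ * _); apply: eq_integral => x _.
  by rewrite fsumEFin// -fimfunE.
transitivity (limn (fun n => \int[Pr]_w (f_ n (xi w) * g w)%:E)).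
  rewrite -monotone_convergence//=.
  - apply: eq_integral => w _; apply/esym/cvg_lim => //.
    under eq_fun do rewrite EFinM.
    by rewrite EFinM; apply: cvgeZr => //; exact: cvgf.
  - by move=> n; exact/measurable_EFinP.
  - by move=> n w _; rewrite lee_fin mulr_ge0.
  - by move=> w _ a b ab; rewrite lee_fin ler_wpM2r// ndf.
rewrite (_ : \int[P]_x _ = limn (fun n => \int[P]_x (f_ n x)%:E)); last first.
  rewrite -monotone_convergence//=.
  - by apply: eq_integral => x _; apply/esym/cvg_lim => //; exact: cvgf.
  - by move=> n; exact/measurable_EFinP/measurable_funTS.
  - by move=> n x _; rewrite lee_fin.
  - by move=> x _ a b ab; rewrite lee_fin ndf.
rewrite -limeMl//; first by congr (limn _); apply/funext => n; rewrite simple.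
apply/ereal_nondecreasing_is_cvgn => a b ab; apply: ge0_le_integral => //.
- by move=> x _; rewrite lee_fin.
- exact/measurable_EFinP/measurable_funTS.
- exact/measurable_EFinP/measurable_funTS.
- by move=> x _; rewrite lee_fin ndf.
Qed.

Variables (N : nat) (xi : nat -> W -> Omega).
Hypothesis mxi : forall t, (t < N)%N -> measurable_fun setT (xi t).
Hypothesis rect : forall B : nat -> set Omega, (forall t, measurable (B t)) ->
  Pr (\bigcap_(t in `I_N) (xi t @^-1` B t)) = \prod_(t < N) P (B t).

Lemma measurable_prod_comp (Q : pred 'I_N) (f : nat -> Omega -> R) :
  (forall t, measurable_fun setT (f t)) ->
  measurable_fun setT (fun w => \prod_(t < N | Q t) f t (xi t w))%R.
Proof.
move=> mf; under eq_fun do rewrite -big_filter.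
by apply: measurable_prod => t _; apply: measurableT_comp => //; exact: mxi.
Qed.

(** Independence is given on rectangles only. The factors are freed one at a time: the induction is
    on the number k of leading factors that may be arbitrary, the others being indicators. *)
Lemma integral_prod_comp (f : nat -> Omega -> R) (e : nat -> R) :
  (forall t, measurable_fun setT (f t)) -> (forall t x, 0 <= f t x)%R ->
  (forall t, \int[P]_x (f t x)%:E = (e t)%:E) ->
  \int[Pr]_w (\prod_(t < N) f t (xi t w))%:E = (\prod_(t < N) e t)%:E.
Proof.
suff H k : (k <= N)%N -> forall (f : nat -> Omega -> R) (e : nat -> R) (B : nat -> set Omega),
    (forall t, measurable_fun setT (f t)) -> (forall t x, 0 <= f t x)%R ->
    (forall t, \int[P]_x (f t x)%:E = (e t)%:E) ->
    (forall t, measurable (B t)) -> (forall t, (k <= t)%N -> f t = \1_(B t)) ->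
    \int[Pr]_w (\prod_(t < N) f t (xi t w))%:E = (\prod_(t < N) e t)%:E.
  move=> mf f0 fe.
  (* The induction wants indicators at every index from k on, hence also beyond the N draws, where
     the constant 1 is put. *)
  pose f' t := if (t < N)%N then f t else \1_setT.
  pose e' t := if (t < N)%N then e t else 1%R.
  have := H N (leqnn N) f' e' (fun=> setT) => /(_ _ _ _ _ _) h.
  rewrite (eq_bigr (fun t : 'I_N => e' t)); last by move=> t _; rewrite /e' ltn_ord.
  rewrite -h.
  - by apply: eq_integral => w _; congr EFin; apply: eq_bigr => t _; rewrite /f' ltn_ord.
  - by move=> t; rewrite /f'; case: ifP => // _; exact: measurable_indic.
  - by move=> t x; rewrite /f'; case: ifP.
  - move=> t; rewrite /f' /e'; case: ifP => // _.
    rewrite integral_indic// setIT; exact: probability_setT.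
  - by [].
  - by move=> t Nt; rewrite /f' ltnNge Nt.
elim: k => [_|k IH kN] {}f {}e B mf f0 fe mB fB.
  transitivity (\int[Pr]_w (\1_(\bigcap_(t in `I_N) (xi t @^-1` B t)) w)%:E).
    apply: eq_integral => w _; congr EFin.
    rewrite indicE; have [wB|wB] := boolP (w \in _).
      rewrite big1// => t _; rewrite fB// indicE mem_set//.
      by move: wB; rewrite inE => /(_ t); apply; exact: ltn_ord.
    apply/eqP; move: wB; rewrite notin_setE => /existsNP[t /not_implyP[tN ntB]].
    apply/prodf_eq0; exists (Ordinal tN) => //=.
    by rewrite fB// indicE memNset.
  have mcap : measurable (\bigcap_(t in `I_N) (xi t @^-1` B t)).
    apply: bigcap_measurableType => t tN.
    by rewrite -[X in measurable X]setTI; exact: mxi.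
  rewrite integral_indic// setIT; etransitivity; first exact: (rect mB).
  rewrite (eq_bigr (fun t : 'I_N => (e t)%:E)) ?prodEFin// => t _.
  by rewrite -fe fB// integral_indic// setIT.
have {}IH := IH (ltnW kN).
pose k' := Ordinal kN.
pose g w := (\prod_(t < N | t != k') f t (xi t w))%R.
pose c := (\prod_(t < N | t != k') e t)%R.
have e0 t : (0 <= e t)%R.
  by rewrite -lee_fin -fe integral_ge0// => x _; rewrite lee_fin.
have c0 : (0 <= c)%R by apply: prodr_ge0.
have mg : measurable_fun setT g by exact: measurable_prod_comp.
have g0 w : (0 <= g w)%R by apply: prodr_ge0.
have key B' : measurable B' -> \int[Pr]_w (\1_B' (xi k w) * g w)%:E = c%:E * P B'.
  move=> mB'.
  pose f' t := if t == k then \1_B' else f t.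
  pose e' t := if t == k then fine (P B') else e t.
  have -> : c%:E * P B' = (\prod_(t < N) e' t)%:E.
    rewrite (bigD1 k')//= {1}/e' eqxx muleC EFinM fineK ?fin_num_measure//.
    congr (_ * _%:E); apply: eq_bigr => t tk.
    by rewrite /e'; case: eqP => // tk'; move: tk; rewrite -val_eqE/= tk' eqxx.
  rewrite -(IH f' e' (fun t => if t == k then B' else B t)).
  - apply: eq_integral => w _; congr EFin; rewrite [RHS](bigD1 k')//= {1}/f' eqxx.
    congr (_ * _)%R; apply: eq_bigr => t tk.
    by rewrite /f'; case: eqP => // tk'; move: tk; rewrite -val_eqE/= tk' eqxx.
  - by move=> t; rewrite /f'; case: ifP => // _; exact: measurable_indic.
  - by move=> t x; rewrite /f'; case: ifP.
  - move=> t; rewrite /f' /e'; case: ifP => // _.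
    by rewrite integral_indic// setIT fineK// fin_num_measure.
  - by move=> t; case: ifP.
  - move=> t kt; rewrite /f'; case: eqP => // /eqP tk; rewrite fB//.
    by rewrite ltn_neqAle eq_sym tk.
rewrite (bigD1 k')//= EFinM muleC -/c -fe.
rewrite -(integral_comp_mul (mxi kN) mg g0 c0 key)//.
by apply: eq_integral => w _; rewrite (bigD1 k').
Qed.

End ProductExpectation.

(** * Elementary inequalities for the exponential *)

Section RealExponential.
Variable R : realType.
Implicit Types y z : R.

Lemma expR_half_bounds : 3 / 2 <= expR (1 / 2 : R) <= 2.
Proof.
have h1 := expR_ge1Dx (1 / 2 : R); have h2 := expR_ge1Dx (- (1 / 2) : R).
have h3 : expR (1 / 2 : R) * expR (- (1 / 2)) = 1 by rewrite -expRD subrr expR0.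
have h4 := expR_gt0 (1 / 2 : R).
apply/andP; split; first lra.
by nra.
Qed.

Lemma sqr_le_expR z : 0 <= z -> z ^+ 2 <= 4 * expR z.
Proof.
move=> z0; have h := expR_ge1Dx (z / 2).
have -> : expR z = expR (z / 2) ^+ 2.
  by rewrite expr2 -expRD; congr expR; field.
by nra.
Qed.

(** The inequality 1 - y <= exp(-y), multiplied by exp y, gives exp y <= 1 + y exp y; for y >= 0 it
    is inserted into itself. For a centred variable the linear term integrates to 0. *)
Lemma expR_le_quadratic y : expR y <= 1 + y + y ^+ 2 * expR `|y|.
Proof.
have h1 := expR_ge1Dx y; have h2 := expR_ge1Dx (- y).
have h3 : expR y * expR (- y) = 1 by rewrite -expRD subrr expR0.
have h4 := expR_gt0 y; have h5 := expR_gt0 (- y).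
have h6 : expR y <= 1 + y * expR y.
  have := ler_wpM2l (ltW h4) h2; rewrite h3; lra.
have [y0|y0] := leP 0 y.
  have := ler_wpM2l y0 h6; rewrite ger0_norm//; lra.
have h7 : 1 <= expR `|y| by have := expR_ge1Dx `|y|; have := normr_ge0 y; lra.
have h8 : - y * (1 - expR y) <= - y * - y by apply: ler_wpM2l; lra.
have := ler_wpM2l (sqr_ge0 y) h7; rewrite mulr1; nra.
Qed.

End RealExponential.

(** * Exponential moments from a sub-exponential tail *)

Section SubExponential.
Local Open Scope ereal_scope.
Context (R : realType) (dO : measure_display) (Omega : measurableType dO).
Context (P : probability Omega R) (X : Omega -> R) (s : R).
Hypothesis mX : measurable_fun setT X.
Hypothesis s0 : (0 < s)%R.
Hypothesis tailX : forall t : R, (0 <= t)%R ->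
  P [set w | (t <= `|X w|)%R] <= (2 * expR (- (t / s)))%:E.

Lemma measurable_tail t : measurable [set w | (t <= `|X w|)%R].
Proof.
rewrite -[X in measurable X]setTI.
rewrite (_ : [set w | _] = (fun w => `|X w|%R) @^-1` `[t, +oo[%classic).
  by apply: (measurableT_comp _ mX) => //; exact: measurable_itv.
by apply/seteqP; split => w /=; rewrite in_itv/= andbT.
Qed.

Lemma sum_geometric_le n :
  \sum_(0 <= k < n) (4 * (2 / 3) ^+ k : R)%:E <= 12%:E.
Proof.
rewrite sumEFin lee_fin.
have -> : (\sum_(0 <= k < n) 4 * (2 / 3) ^+ k = 12 - 12 * (2 / 3) ^+ n :> R)%R.
  elim: n => [|n IH]; first by rewrite big_nil expr0 mulr1 subrr.
  by rewrite big_nat_recr//= IH exprS; field.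
by have := exprn_ge0 n (_ : 0 <= 2 / 3 :> R)%R; lra.
Qed.

(** Shells of width s: the integrand is at most the sum over k of exp((k+1)/2) on the event |X| >= k
    s, of probability at most 2 exp(-k). As exp(1/2) <= 2 and exp(-1/2) <= 2/3, the terms are at
    most 4 (2/3)^k, with sum 12. *)
Lemma exp_moment : \int[P]_w (expR (`|X w| / (2 * s)))%:E <= 12%:E.
Proof.
pose a k : R := expR (k.+1%:R / 2).
pose A k := [set w | (k%:R * s <= `|X w|)%R].
have mterm k : measurable_fun setT (fun w => (a k * \1_(A k) w)%:E).
  apply/measurable_EFinP; apply: measurable_funM => //.
  by apply: measurable_indic; exact: measurable_tail.
have term0 k w : setT w -> 0 <= (a k * \1_(A k) w)%:E.
  by move=> _; rewrite lee_fin mulr_ge0// expR_ge0.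
apply: (@le_trans _ _ (\int[P]_w \sum_(k <oo) (a k * \1_(A k) w)%:E)).
  apply: ge0_le_integral => //.
  - apply/measurable_EFinP; apply: measurableT_comp => //.
    by apply: measurable_funM => //; exact: measurableT_comp.
  - by apply: ge0_emeasurable_sum => // k w _ _; exact: term0.
  move=> w _; pose K := Num.truncn (`|X w| / s).
  have Xs0 : (0 <= `|X w| / s)%R by rewrite divr_ge0// ltW.
  have /andP[K1 K2] := truncn_itv Xs0; rewrite -/K in K1 K2.
  apply: le_trans (nneseries_lim_ge K.+1 _); last by move=> k _ _; exact: term0.
  rewrite big_nat_recr//=; apply: (@le_trans _ _ (a K * \1_(A K) w)%:E).
    rewrite indicE mem_set ?mulr1; last by rewrite /A/= -ler_pdivlMr.
    rewrite lee_fin ler_expR invfM mulrA -mulrA (mulrC 2^-1%R) mulrA.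
    by rewrite ler_wpM2r// ltW.
  by rewrite leeDr// sume_ge0// => k _; exact: term0.
rewrite integral_nneseries//.
apply: (@le_trans _ _ (\sum_(k <oo) (4 * (2 / 3) ^+ k : R)%:E)).
  apply: lee_nneseries => [k _ _|k _].
    by apply: integral_ge0 => w _; exact: term0.
  under eq_integral do rewrite EFinM.
  rewrite ge0_integralZl//; first last.
  - by rewrite lee_fin expR_ge0.
  - by apply/measurable_EFinP/measurable_indic/measurable_tail.
  rewrite integral_indic//; last exact: measurable_tail.
  rewrite setIT.
  have k0 : (0 <= k%:R * s)%R by rewrite mulr_ge0// ltW.
  apply: (@le_trans _ _ ((a k)%:E * (2 * expR (- (k%:R * s / s)))%:E)).
    by apply: lee_wpmul2l; [rewrite lee_fin expR_ge0|exact: tailX].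
  rewrite mulfK ?gt_eqF// -EFinM lee_fin /a.
  have /andP[e1 e2] := expR_half_bounds R.
  have -> : (expR (k.+1%:R / 2) * (2 * expR (- k%:R)) =
      2 * expR (1 / 2) * expR (- (1 / 2)) ^+ k :> R)%R.
    have <- : (expR (k%:R * - (1 / 2)) = expR (- (1 / 2) : R) ^+ k)%R by rewrite expRM_natl.
    rewrite mulrCA -expRD -mulrA -expRD; congr (_ * expR _)%R.
    by rewrite -natr1; field.
  have e3 : (expR (1 / 2 : R) * expR (- (1 / 2)) = 1)%R by rewrite -expRD subrr expR0.
  have e4 := expR_gt0 (- (1 / 2) : R).
  apply: ler_pM; [by lra|by rewrite exprn_ge0// ltW|by lra|].
  by apply: lerXn2r; rewrite ?nnegrE; [exact: ltW|lra|nra].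
apply: lime_le; first by apply: is_cvg_nneseries => k _ _; rewrite lee_fin mulr_ge0// exprn_ge0.
by apply: nearW => n; exact: sum_geometric_le.
Qed.


Let Y w : R := expR (`|X w| / (2 * s)).

Let mY : measurable_fun setT Y.
Proof.
by apply: measurableT_comp => //; apply: measurable_funM => //; exact: measurableT_comp.
Qed.

Let intY : P.-integrable setT (EFin \o Y).
Proof.
apply/integrableP; split; first exact/measurable_EFinP.
under eq_integral do rewrite /= ger0_norm ?expR_ge0//.
by apply: le_lt_trans exp_moment _; rewrite ltry.
Qed.

Lemma integrable_subexp : P.-integrable setT (EFin \o X).
Proof.
apply: (@le_integrable _ _ _ _ _ _ _ (EFin \o (fun w => 2 * s * Y w)%R)) => //.
- exact/measurable_EFinP.
- move=> w _ /=; rewrite lee_fin; have s2 : (0 < 2 * s)%R by rewrite mulr_gt0.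
  rewrite [leRHS]ger0_norm ?mulr_ge0 ?expR_ge0 ?(ltW s0)//.
  have h : (`|X w| / (2 * s) <= Y w)%R by apply: le_trans (expR_ge1Dx _); rewrite lerDr.
  by rewrite ler_pdivrMr// mulrC in h.
rewrite (_ : EFin \o _ = fun w => (2 * s)%:E * (Y w)%:E)//.
by apply: (integrableZl measurableT _ intY).
Qed.

(** With y = lam X and z = |X| / (4 s), the assumption on [lam] gives |y| <= z, so y^2 exp |y| <= 16
    lam^2 s^2 z^2 exp z <= 64 lam^2 s^2 exp(2 z). The last exponential is the one whose mean is at
    most 12. *)
Lemma mgf_le (lam : R) : \int[P]_w (X w)%:E = 0 -> (`|lam| * (4 * s) <= 1)%R ->
  \int[P]_w (expR (lam * X w))%:E <= (1 + 12 * 64 * lam ^+ 2 * s ^+ 2)%:E.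
Proof.
move=> EX lams; have iX := integrable_subexp.
have i1 : P.-integrable setT (EFin \o cst 1%R).
  exact: (finite_measure_integrable_cst P 1%R).
have i2 : P.-integrable setT (fun w => lam%:E * (X w)%:E) by exact: integrableZl.
have i3 : P.-integrable setT (fun w => (64 * lam ^+ 2 * s ^+ 2)%:E * (Y w)%:E).
  exact: integrableZl.
apply: (@le_trans _ _ (\int[P]_w ((1%:E + lam%:E * (X w)%:E) +
    (64 * lam ^+ 2 * s ^+ 2)%:E * (Y w)%:E))).
  apply: ge0_le_integral => //.
  - by apply/measurable_EFinP; apply: measurableT_comp => //; exact: measurable_funM.
  - apply: emeasurable_funD; [apply: emeasurable_funD|].
    + exact: (measurable_int P i1).
    + exact: (measurable_int P i2).
    + exact: (measurable_int P i3).
  move=> w _; rewrite -!EFinM -!EFinD lee_fin.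
  apply: le_trans (expR_le_quadratic _) _; rewrite lerD2l.
  have s4 : (0 < 4 * s)%R by rewrite mulr_gt0.
  set z := (`|X w| / (4 * s))%R; have z0 : (0 <= z)%R by rewrite divr_ge0// ltW.
  have zE : (`|X w| = z * (4 * s))%R by rewrite /z divfK// gt_eqF.
  have h1 : (`|lam * X w| <= z)%R.
    rewrite normrM zE mulrCA -[leRHS]mulr1; exact: ler_wpM2l.
  have -> : Y w = (expR z * expR z)%R.
    by rewrite /Y -expRD zE; congr expR; field; rewrite gt_eqF.
  have -> : ((lam * X w) ^+ 2 = 16 * lam ^+ 2 * s ^+ 2 * z ^+ 2)%R.
    by rewrite exprMn -[(X w ^+ 2)%R]real_normK ?num_real// zE; ring.
  have h2 := sqr_le_expR z0; have h3 : (expR `|lam * X w| <= expR z)%R by rewrite ler_expR.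
  have h4 : (z ^+ 2 * expR `|lam * X w| <= 4 * expR z * expR z)%R.
    by apply: ler_pM => //; rewrite ?sqr_ge0 ?expR_ge0.
  have h5 : (0 <= 16 * lam ^+ 2 * s ^+ 2)%R.
    by apply: mulr_ge0; rewrite ?sqr_ge0//; apply: mulr_ge0; rewrite ?sqr_ge0.
  by have := ler_wpM2l h5 h4; lra.
rewrite integralD//; last exact: integrableD.
rewrite integralD// integralZl// EX mule0 adde0 integralZl//.
rewrite (_ : \int[P]_x 1%:E = 1%:E); last first.
  by rewrite integral_cst// mul1e; exact: probability_setT.
rewrite [in leRHS]EFinD leeD2l//.
apply: (@le_trans _ _ ((64 * lam ^+ 2 * s ^+ 2)%:E * 12%:E)).
  apply: lee_wpmul2l; last exact: exp_moment.
  by rewrite lee_fin; apply: mulr_ge0; rewrite ?sqr_ge0//; apply: mulr_ge0; rewrite ?sqr_ge0.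
by rewrite -EFinM lee_fin; lra.
Qed.

End SubExponential.

(** * Bernstein's inequality on a rectangle of past draws *)

Section Bernstein.
Local Open Scope ereal_scope.
Context (R : realType) (dW dO : measure_display).
Context (W : measurableType dW) (Omega : measurableType dO).
Context (Pr : probability W R) (P : probability Omega R).
Variables (N : nat) (xi : nat -> W -> Omega).
Hypothesis mxi : forall t, (t < N)%N -> measurable_fun setT (xi t).
Hypothesis rect : forall B : nat -> set Omega, (forall t, measurable (B t)) ->
  Pr (\bigcap_(t in `I_N) (xi t @^-1` B t)) = \prod_(t < N) P (B t).

Lemma measurable_history (n : nat) (B : nat -> set Omega) :
  (n <= N)%N -> (forall t, measurable (B t)) ->
  measurable (\bigcap_(t in `I_n) (xi t @^-1` B t)).
Proof.
move=> nN mB; apply: bigcap_measurableType => t /= tn.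
by rewrite -[X in measurable X]setTI; apply: mxi => //; exact: leq_trans tn nN.
Qed.

Lemma indic_history (n : nat) (B : nat -> set Omega) w :
  \1_(\bigcap_(t in `I_n) (xi t @^-1` B t)) w =
  (\prod_(0 <= t < n) \1_(B t) (xi t w))%R :> R.
Proof.
rewrite big_mkord indicE; have [wB|wB] := boolP (w \in _).
  rewrite big1// => t _; rewrite indicE mem_set//.
  by move: wB; rewrite inE => /(_ t); apply; exact: ltn_ord.
apply/esym/eqP; move: wB; rewrite notin_setE => /existsNP[t /not_implyP[tn ntB]].
by apply/prodf_eq0; exists (Ordinal tn) => //=; rewrite indicE memNset.
Qed.

(** Conditional independence of the next m draws from a rectangular past. The factors are indicators
    before n, [phi] within the block and 1 after it. *)
Lemma integral_history (n m : nat) (B : nat -> set Omega) (phi : Omega -> R) (M : R) :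
  (n + m <= N)%N -> (forall t, measurable (B t)) ->
  measurable_fun setT phi -> (forall x, 0 <= phi x)%R -> \int[P]_x (phi x)%:E = M%:E ->
  \int[Pr]_w (\1_(\bigcap_(t in `I_n) (xi t @^-1` B t)) w *
     \prod_(i < m) phi (xi (n + i) w))%:E =
  ((\prod_(0 <= t < n) fine (P (B t))) * M ^+ m)%:E.
Proof.
move=> nmN mB mphi phi0 phiM.
pose f t : Omega -> R := if (t < n)%N then \1_(B t)
  else if (t < n + m)%N then phi else \1_setT.
pose e t : R := if (t < n)%N then fine (P (B t)) else if (t < n + m)%N then M else 1%R.
have fold (V : Type) (F : nat -> R) : (\prod_(t < N) F t =
    \prod_(0 <= t < n) F t * (\prod_(i < m) F (n + i)%N * \prod_(n + m <= t < N) F t))%R.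
  rewrite -(big_mkord xpredT) (@big_cat_nat _ _ _ n)//=; last first.
    by rewrite (leq_trans _ nmN)// leq_addr.
  rewrite (@big_cat_nat _ _ _ (n + m) n)//= ?leq_addr//; congr (_ * (_ * _))%R.
  by rewrite -{1}[n]add0n big_addn addKn big_mkord; apply: eq_bigr => i _; rewrite addnC.
have eE : (\prod_(t < N) e t = (\prod_(0 <= t < n) fine (P (B t))) * M ^+ m)%R.
  rewrite (fold nat); congr (_ * _)%R.
    by apply: eq_big_nat => t /andP[_ tn]; rewrite /e tn.
  rewrite [X in (_ * X)%R]big_nat_cond [X in (_ * X)%R]big1 ?mulr1; last first.
    move=> t /andP[/andP[nmt _] _].
    by rewrite /e ltnNge (leq_trans (leq_addr _ _) nmt)/= ltnNge nmt.
  rewrite (eq_bigr (fun=> M)) ?prodr_const ?card_ord// => i _.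
  by rewrite /e ltnNge leq_addr/= ltn_add2l ltn_ord.
rewrite -eE -(@integral_prod_comp _ _ _ _ _ Pr P _ _ mxi rect f e).
- apply: eq_integral => w _; congr EFin; rewrite (fold nat (fun t => f t (xi t w))).
  rewrite indic_history; congr (_ * _)%R.
    by apply: eq_big_nat => t /andP[_ tn]; rewrite /f tn.
  rewrite [X in _ = (_ * X)%R]big_nat_cond [X in _ = (_ * X)%R]big1 ?mulr1; last first.
    move=> t /andP[/andP[nmt _] _].
    by rewrite /f ltnNge (leq_trans (leq_addr _ _) nmt)/= ltnNge nmt/= indicE in_setT.
  apply: eq_bigr => i _.
  by rewrite /f ltnNge leq_addr/= ltn_add2l ltn_ord.
- move=> t; rewrite /f; case: ifP => _; first exact: measurable_indic.
  by case: ifP => _; [exact: mphi|exact: measurable_indic].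
- by move=> t x; rewrite /f; case: ifP => // _; case: ifP.
- move=> t; rewrite /f /e; case: ifP => // _.
    by rewrite integral_indic// setIT fineK// fin_num_measure.
  by case: ifP => // _; rewrite integral_indic// setIT; exact: probability_setT.
Qed.

Lemma probability_history (n : nat) (B : nat -> set Omega) :
  (n <= N)%N -> (forall t, measurable (B t)) ->
  Pr (\bigcap_(t in `I_n) (xi t @^-1` B t)) = (\prod_(0 <= t < n) fine (P (B t)))%:E.
Proof.
move=> nN mB.
have := @integral_history n 0 B (cst 1%R) 1 _ mB _ _ _; rewrite addn0 mulr1 => <-//.
- under eq_integral do rewrite big_ord0 mulr1.
  by rewrite integral_indic ?setIT//; exact: measurable_history.
- by rewrite (integral_cst _ measurableT 1) mul1e; exact: probability_setT.
Qed.

Section OneSided.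
Variables (n m : nat) (B : nat -> set Omega) (X : Omega -> R) (s theta : R).
Hypothesis nmN : (n + m <= N)%N.
Hypothesis mB : forall t, measurable (B t).
Hypothesis mX : measurable_fun setT X.
Hypothesis s0 : (0 < s)%R.
Hypothesis tailX : forall t : R, (0 <= t)%R ->
  P [set w | (t <= `|X w|)%R] <= (2 * expR (- (t / s)))%:E.
Hypothesis EX : \int[P]_w (X w)%:E = 0.
Hypothesis theta0 : (0 < theta)%R.
Hypothesis thetas : (theta <= s)%R.

Let H := \bigcap_(t in `I_n) (xi t @^-1` B t).

Lemma measurable_block_sum :
  measurable_fun setT (fun w => \sum_(i < m) X (xi (n + i) w))%R.
Proof.
apply: measurable_sum => i; apply: measurableT_comp => //; apply: mxi.
by apply: leq_trans nmN; rewrite ltn_add2l.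
Qed.

(** Chernoff's bound restricted to the past [H]. The factor [Pr H] on the right is what lets the
    bounds for different pasts be added. *)
Lemma bernstein_one_sided :
  Pr (H `&` [set w | (m%:R * theta <= \sum_(i < m) X (xi (n + i) w))%R]) <=
  (expR (- (m%:R * theta ^+ 2 / (48 * 64 * s ^+ 2))))%:E * Pr H.
Proof.
have nN : (n <= N)%N by rewrite (leq_trans _ nmN)// leq_addr.
have mH : measurable H by exact: measurable_history.
(* Minimises 12 * 64 lam^2 s^2 - theta lam, with minimum - theta^2 / (48 * 64 s^2). It is admissible
   in [mgf_le] because theta <= s. *)
pose lam := (theta / (24 * 64 * s ^+ 2))%R.
have s2 : (0 < s ^+ 2)%R by rewrite exprn_gt0.
have den0 : (0 < 24 * 64 * s ^+ 2)%R by apply: mulr_gt0 => //; exact: mulr_gt0.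
have lam0 : (0 <= lam)%R by apply: divr_ge0; exact: ltW.
have lams : (`|lam| * (4 * s) <= 1)%R.
  rewrite (ger0_norm lam0) /lam mulrAC ler_pdivrMr//.
  have h : (theta * s <= s ^+ 2)%R by rewrite expr2 ler_pM2r.
  by rewrite mul1r mulrCA; lra.
have mexp : measurable_fun setT (fun w => expR (lam * X w)).
  by apply: measurableT_comp => //; exact: measurable_funM.
have mgf := mgf_le mX s0 tailX EX lams.
pose M := fine (\int[P]_w (expR (lam * X w))%:E).
have Mfin : \int[P]_w (expR (lam * X w))%:E = M%:E.
  rewrite fineK// ge0_fin_numE; first by apply: le_lt_trans mgf _; rewrite ltry.
  by apply: integral_ge0 => w _; rewrite lee_fin expR_ge0.
have M0 : (0 <= M)%R.
  by rewrite -lee_fin -Mfin; apply: integral_ge0 => w _; rewrite lee_fin expR_ge0.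
have Mle : (M <= expR (12 * 64 * lam ^+ 2 * s ^+ 2))%R.
  by rewrite -lee_fin -Mfin; apply: le_trans mgf _; rewrite lee_fin expR_ge1Dx.
have hist := integral_history nmN mB mexp (fun x => expR_ge0 _) Mfin.
have mS : measurable [set w | (m%:R * theta <= \sum_(i < m) X (xi (n + i) w))%R].
  rewrite -[X in measurable X]setTI.
  rewrite (_ : [set w | _] = (fun w => \sum_(i < m) X (xi (n + i) w))%R @^-1`
     `[(m%:R * theta)%R, +oo[%classic); last first.
    by apply/seteqP; split => w /=; rewrite in_itv/= andbT.
  by apply: measurable_block_sum => //; exact: measurable_itv.
have mprod : measurable_fun setT (fun w : W => \prod_(i < m) expR (lam * X (xi (n + i) w)))%R.
  apply: measurable_prod => i _; apply: measurableT_comp => //.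
  apply: measurable_funM => //; apply: measurableT_comp => //; apply: mxi.
  by apply: leq_trans nmN; rewrite ltn_add2l.
pose Q w : R := (\1_H w * \prod_(i < m) expR (lam * X (xi (n + i) w)))%R.
have mQ : measurable_fun setT Q by apply: measurable_funM => //; exact: measurable_indic.
have Q0 w : (0 <= Q w)%R by rewrite mulr_ge0// prodr_ge0// => i _; exact: expR_ge0.
set S := [set w | _] in mS *; have mHS : measurable (H `&` S) by exact: measurableI.
have <- : \int[Pr]_w (\1_(H `&` S) w)%:E = Pr (H `&` S) by rewrite integral_indic// setIT.
apply: (@le_trans _ _ (\int[Pr]_w ((expR (- (m%:R * theta * lam)))%:E * (Q w)%:E))).
  apply: ge0_le_integral => //.
  - by apply/measurable_EFinP/measurable_indic.
  - by apply: emeasurable_funM => //; exact/measurable_EFinP.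
  move=> w _; rewrite -EFinM lee_fin indicE; have [|_] := boolP (w \in _); last first.
    by rewrite mulr_ge0// expR_ge0.
  rewrite inE => -[wH wS]; rewrite /Q indicE mem_set// mul1r -expR_sum -expRD.
  rewrite -[leLHS]expR0 ler_expR -mulr_sumr addrC subr_ge0 mulrC.
  exact: ler_wpM2l.
have mEQ : measurable_fun setT (EFin \o Q) by exact/measurable_EFinP.
rewrite (ge0_integralZl _ measurableT mEQ) ?lee_fin ?expR_ge0//; last first.
  by move=> w _; rewrite lee_fin.
rewrite hist (probability_history nN mB) -!EFinM lee_fin.
set p := (\prod_(_ <= _ < _) _)%R.
have p0 : (0 <= p)%R by apply: prodr_ge0 => t _; rewrite fine_ge0.
rewrite [leRHS]mulrC mulrCA ler_wpM2l//.
apply: (@le_trans _ _ (expR (- (m%:R * theta * lam)) * expR (12 * 64 * lam ^+ 2 * s ^+ 2) ^+ m)%R).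
  by apply: ler_wpM2l; [exact: expR_ge0|apply: lerXn2r; rewrite ?nnegrE ?expR_ge0].
rewrite -expRM_natl -expRD ler_expR /lam le_eqVlt; apply/orP; left; apply/eqP.
by field; rewrite gt_eqF.
Qed.

End OneSided.

Lemma bernstein (n m : nat) (B : nat -> set Omega) (X : Omega -> R) (s theta : R) :
  (n + m <= N)%N -> (forall t, measurable (B t)) -> measurable_fun setT X -> (0 < s)%R ->
  (forall t : R, (0 <= t)%R ->
     P [set w | (t <= `|X w|)%R] <= (2 * expR (- (t / s)))%:E) ->
  \int[P]_w (X w)%:E = 0 -> (0 < theta)%R -> (theta <= s)%R ->
  let H := \bigcap_(t in `I_n) (xi t @^-1` B t) in
  let S := [set w | (m%:R * theta <= `|\sum_(i < m) X (xi (n + i) w)|)%R] in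
  measurable (H `&` S) /\
  Pr (H `&` S) <= (2 * expR (- (m%:R * theta ^+ 2 / (48 * 64 * s ^+ 2))))%:E * Pr H.
Proof.
move=> nmN mB mX s0 tailX EX theta0 thetas H S.
pose T (Z : Omega -> R) := [set w | (m%:R * theta <= \sum_(i < m) Z (xi (n + i) w))%R].
have nN : (n <= N)%N by rewrite (leq_trans _ nmN)// leq_addr.
have mH : measurable H by exact: measurable_history.
have mT (Z : Omega -> R) : measurable_fun setT Z -> measurable (T Z).
  move=> mZ; rewrite -[X in measurable X]setTI.
  rewrite (_ : T Z = (fun w => \sum_(i < m) Z (xi (n + i) w))%R @^-1`
     `[(m%:R * theta)%R, +oo[%classic); last first.
    by apply/seteqP; split => w /=; rewrite in_itv/= andbT.
  by apply: measurable_block_sum => //; exact: measurable_itv.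
have mNX : measurable_fun setT (\- X)%R by exact: measurableT_comp.
have SE : S = T X `|` T (\- X)%R.
  apply/seteqP; split => w; rewrite /S /T /=.
    by rewrite sumrN ler_normr => /orP[]; [left|right].
  by rewrite sumrN ler_normr => -[->//|->]; rewrite orbT.
have mS : measurable S by rewrite SE; apply: measurableU; exact: mT.
split; first exact: measurableI.
rewrite SE setIUr; apply: le_trans (measureU2 _ _ _) _; [exact: measurableI (mT _ _)|exact: measurableI (mT _ _)|].
have h1 := bernstein_one_sided nmN mB mX s0 tailX EX theta0 thetas.
have h2 := @bernstein_one_sided n m B (\- X)%R s theta nmN mB mNX s0 _ _ theta0 thetas.
rewrite mulr_natl mulr2n EFinD ge0_muleDl ?lee_fin ?expR_ge0//.
apply: leeD => //; apply: h2.
  by move=> t t0; under eq_set do rewrite normrN; exact: tailX.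
have iX : P.-integrable setT (EFin \o X) := integrable_subexp mX s0 tailX.
under eq_integral do rewrite /= -mulN1r EFinM.
by rewrite (integralZl measurableT iX) EX mule0.
Qed.

End Bernstein.

(** Total probability over the countably many values of [h]. Each [bad z] has to be measurable only
    on the cell where h = z, so no joint measurability is called for. *)
Lemma countable_union_bound (R : realType) (dW : measure_display)
    (W : measurableType dW) (Pr : probability W R) (Z : countType) (h : W -> Z)
    (bad : Z -> set W) (p : R) :
  0 <= p -> (forall z, measurable (h @^-1` [set z])) ->
  (forall z, measurable (h @^-1` [set z] `&` bad z)) ->
  (forall z, (Pr (h @^-1` [set z] `&` bad z) <= p%:E * Pr (h @^-1` [set z]))%E) ->
  measurable [set w | bad (h w) w] /\ (Pr [set w | bad (h w) w] <= p%:E)%E.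
Proof.
move=> p0 mh mbad hbad.
pose F (G : Z -> set W) (i : nat) : set W := if pickle_inv i is Some z then G z else set0.
pose H z := h @^-1` [set z]; pose Bz z := H z `&` bad z.
have mF G : (forall z, measurable (G z)) -> forall i, measurable (F G i).
  by move=> mG i; rewrite /F; case: pickle_inv.
have badE : [set w | bad (h w) w] = \bigcup_i F Bz i.
  apply/seteqP; split => [w /= bw|w [i _]].
    by exists (pickle (h w)) => //; rewrite /F pickleK_inv; split.
  by rewrite /F; case: (pickle_inv i) => // z [<-].
have mbadU : measurable (\bigcup_i F Bz i) by apply: bigcup_measurable => // i _; exact: mF.
have trivF : trivIset setT (F H).
  apply/trivIsetP => i j _ _ ij; apply/seteqP; split => // w [].
  rewrite /F; have := @pickle_invK Z i; have := @pickle_invK Z j.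
  case: (pickle_inv i) => //= z; case: (pickle_inv j) => //= z' zj zi hz hz'.
  by move: ij; rewrite -zi -zj -hz -hz' eqxx.
rewrite badE; split => //.
apply: le_trans (measure_sigma_subadditive Pr (mF _ mbad) mbadU (@subset_refl _ _)) _.
apply: (@le_trans _ _ (\sum_(i <oo) p%:E * Pr (F H i))%E).
  apply: lee_nneseries => [i _ _|i _]; first exact: measure_ge0.
  by rewrite /F; case: (pickle_inv i) => [z|]; [exact: hbad|rewrite !measure0 mule0].
rewrite nneseriesZl//.
have <- : Pr (\bigcup_i F H i) = (\sum_(i <oo) Pr (F H i))%E.
  apply/esym/cvg_lim => //; apply: measure_semi_sigma_additive => //; first exact: mF.
  by apply: bigcup_measurable => // i _; exact: mF.
rewrite -[leRHS]mule1 lee_wpmul2l ?lee_fin//; apply: probability_le1.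
by apply: bigcup_measurable => // i _; exact: mF.
Qed.

(** * Convex functions *)

Section Convexity.
Variables (R : realType) (d : nat).
Implicit Types (f : 'rV[R]_d -> R) (x y v : 'rV[R]_d).

Lemma derive_gradient f x v : differentiable f x -> 'D_v f x = dotp (gradient f x) v.
Proof.
move=> df; rewrite deriveE// {1}(row_sum_delta v) linear_sum/=.
by apply: eq_bigr => i _; rewrite linearZ/= mxE deriveE// mulrC.
Qed.

(** The difference quotient is controlled only for 0 < h < 1, hence the passage to the limit from
    the right. *)
Lemma derive_le f x v (b : R) : differentiable f x ->
  (forall h, 0 < h -> h < 1 -> f (h *: v + x) - f x <= h * b) -> 'D_v f x <= b.
Proof.
move=> df hb; have dv := diff_derivable (v := v) df.
have c : (fun h => h^-1 *: ((f \o shift x) (h *: v) - f x)) @ (0 : R)^'+ --> 'D_v f x.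
  move=> A /dv /nbhs_ballP [_ /posnumP[e] xe_A].
  by exists e%:num => //= y xe_y /gt_eqF/negbT/xe_A; exact.
apply: (cvgr_to_le c); near=> h.
have h0 : 0 < h by near: h; exact: nbhs_right_gt.
have h1 : h < 1 by near: h; exact: nbhs_right_lt.
by rewrite /= [_ *: _]mulrC ler_pdivrMr// mulrC hb.
Unshelve. all: by end_near. Qed.

Lemma convex_gradient_le f x y : differentiable f x ->
  @convex_function R 'rV[R]_d setT f -> dotp (gradient f x) (y - x) <= f y - f x.
Proof.
move=> df cf; rewrite -derive_gradient//; apply: derive_le => // h h0 h1.
have H : f (h *: y + (1 - h) *: x) <= h * f y + (1 - h) * f x.
  exact: cf (@Itv01 R h (ltW h0) (ltW h1)) y x (in_setT _) (in_setT _).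
have -> : h *: (y - x) + x = h *: y + (1 - h) *: x.
  by rewrite scalerBr scalerBl scale1r addrAC addrA.
lra.
Qed.

Lemma gradient_enorm_le f x (L : R) v : differentiable f x -> elipschitz L f ->
  dotp (gradient f x) v <= L * enorm v.
Proof.
move=> df Lf; rewrite -derive_gradient//; apply: derive_le => // h h0 h1.
apply: le_trans (ler_norm _) _; apply: le_trans (Lf _ _) _.
by rewrite addrK enormZ gtr0_norm// mulrCA.
Qed.

(* Jensen's inequality, from the gradient inequality at the barycentre. *)
Lemma convex_simplex f (T : nat) (l : 'rV[R]_T) (x : 'I_T -> 'rV[R]_d) :
  (forall z, differentiable f z) -> @convex_function R 'rV[R]_d setT f ->
  (forall i, 0 <= l ord0 i) -> \sum_i l ord0 i = 1 ->
  f (\sum_i l ord0 i *: x i) <= \sum_i l ord0 i * f (x i).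
Proof.
move=> df cf l0 l1; set z := \sum_i _ *: _.
have : \sum_i l ord0 i * dotp (gradient f z) (x i - z) <= \sum_i l ord0 i * (f (x i) - f z).
  by apply: ler_sum => i _; rewrite ler_wpM2l// convex_gradient_le.
under [X in X <= _]eq_bigr do rewrite -dotpZr scalerBr.
rewrite -dotp_sumr sumrB -scaler_suml l1 scale1r subrr dotp0r.
under eq_bigr do rewrite mulrBr.
by rewrite sumrB -mulr_suml l1 mul1r subr_ge0.
Qed.

Lemma eps_optimal_minimizer f (eps : R) x y : minimizer f x -> f y <= f x + eps ->
  eps_optimal eps f y.
Proof.
move=> fx fy; rewrite /eps_optimal (_ : inf (range f) = f x)//.
apply/eqP; rewrite eq_le; apply/andP; split.
  by apply: ge_inf; [exists (f x) => _ [z _ <-]; exact: fx|exists x].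
by apply: lb_le_inf => [|_ [z _ <-]]; [exists (f x), x|exact: fx].
Qed.

End Convexity.

(** * The batched algorithm *)

Section Rounding.
Variables (R : realType) (d : nat) (tau : R).
Hypothesis tau0 : 0 < tau.

Lemma measurable_coord (j : 'I_d) :
  measurable_fun setT (fun v : borel_rV R d => (v : 'rV[R]_d) ord0 j).
Proof.
apply: (measurability _ (RGenOInfty.measurableE R)) => //.
move=> _ [_ [a ->] <-]; rewrite setTI; apply: sub_sigma_algebra.
have -> : `]a, +oo[%classic = [set x : R | a < x].
  by apply/seteqP; split => x /=; rewrite in_itv/= andbT.
have /continuousP := @coord_continuous R 1 d ord0 j; apply; exact: open_gt.
Qed.

Definition grid_index (v : 'rV[R]_d) : 'rV[int]_d := \row_j Num.floor (v ord0 j / tau).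

Definition grid_point (z : 'rV[int]_d) : 'rV[R]_d := \row_j (tau * (z ord0 j)%:~R).

Lemma grid_point_index v u : enorm u <= 1 ->
  `|dotp (grid_point (grid_index v) - v) u| <= tau * d%:R.
Proof.
move=> u1; apply: le_trans (dotp_enorm_abs _ _) _.
apply: (@le_trans _ _ (enorm (grid_point (grid_index v) - v))).
  by rewrite -[leRHS]mulr1 ler_wpM2l ?enorm_ge0.
apply: enorm_le_coord => i; rewrite !mxE.
have /andP[h1 h2] := floor_itv (v ord0 i / tau).
rewrite ler_pdivlMr// in h1; rewrite ltr_pdivrMr// in h2.
rewrite intrD in h2; rewrite ler_norml; lra.
Qed.

Lemma measurable_grid_index z : measurable [set v : borel_rV R d | grid_index v = z].
Proof.
have -> : [set v : borel_rV R d | grid_index v = z] = \bigcap_(j in [set: 'I_d])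
    (fun v : borel_rV R d => (v : 'rV[R]_d) ord0 j) @^-1`
      `[(z ord0 j)%:~R * tau, (z ord0 j + 1)%:~R * tau[%classic.
  apply/seteqP; split => [v /= <- j _ /=|v /= h].
    rewrite in_itv/= mxE -ler_pdivlMr// -ltr_pdivrMr//; exact: floor_itv.
  apply/rowP => j; rewrite mxE; apply/floor_def.
  by have := h j I; rewrite /= in_itv/= -ler_pdivlMr// -ltr_pdivrMr.
apply: fin_bigcap_measurable => // j _.
rewrite -[X in measurable X]setTI; apply: measurable_coord => //.
Qed.

(** [G] is arbitrary: it is applied to one of countably many grid sequences, so every preimage is a
    countable union of finite intersections of measurable cells. *)
Lemma measurable_grid_fun (dS : measure_display) (T : measurableType dS) (t : nat)
  (G : seq 'rV[int]_d -> 'rV[R]_d) :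
  measurable_fun setT (fun p : T * t.-tuple (borel_rV R d) =>
     G [seq grid_index a | a <- p.2] : borel_rV R d).
Proof.
move=> _ A mA; rewrite setTI.
pose H (z : seq 'rV[int]_d) := [set p : T * t.-tuple (borel_rV R d) | [seq grid_index a | a <- p.2] = z].
have mH z : measurable (H z).
  have [zt|zt] := eqVneq (size z) t; last first.
    rewrite (_ : H z = set0)//; apply/seteqP; split => // p /= pz.
    by move: zt; rewrite -pz size_map size_tuple eqxx.
  have -> : H z = \bigcap_(i in [set: 'I_t]) (fun p : T * t.-tuple (borel_rV R d) => tnth p.2 i) @^-1`
      [set v | grid_index v = nth 0 z i].
    apply/seteqP; split => [p /= <- i _ /=|p /= h].
      by rewrite (nth_map 0) ?size_tuple// (tnth_nth 0).
    apply: (@eq_from_nth _ 0) => [|i]; rewrite size_map size_tuple// => it.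
    by rewrite (nth_map 0) ?size_tuple// -(h (Ordinal it) I) (tnth_nth 0).
  apply: fin_bigcap_measurable => // i _.
  rewrite -[X in measurable X]setTI.
  have mt : measurable_fun setT (fun p : T * t.-tuple (borel_rV R d) => tnth p.2 i).
    apply: (@measurableT_comp _ _ _ _ _ _ (fun x => tnth x i)) => //.
    exact: measurable_tnth.
  by apply: mt => //; exact: measurable_grid_index.
have -> : (fun p : T * t.-tuple (borel_rV R d) => G [seq grid_index a | a <- p.2]) @^-1` A =
    \bigcup_i (if pickle_inv i is Some z then (if z \in [set z | A (G z)] then H z else set0) else set0).
  apply/seteqP; split => [p /= Ap|p [i _]].
    by exists (pickle [seq grid_index a | a <- p.2]) => //; rewrite pickleK_inv mem_set.
  case: (pickle_inv i) => // z; case: ifPn => // /set_mem /= Az Hz.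
  by move: Hz; rewrite /H/= => ->.
apply: bigcup_measurable => // i _.
by case: pickle_inv => // z; case: ifP.
Qed.

End Rounding.

Section BatchedAlgorithm.
Variables (R : realType) (d T m : nat) (rad tau tol : R).
Hypothesis rad0 : 0 < rad.
Implicit Types (z : seq 'rV[int]_d).

Definition batch_mean z b : 'rV[R]_d :=
  m%:R^-1 *: \sum_(i < m) grid_point tau (nth 0 z (b * m + i)%N).

Definition batch_means z b := rev (mkseq (batch_mean z) b).

(** The outer ball has radius 2 rad, so that around each point of norm at most rad a ball of radius
    r <= rad still fits in it. *)
Definition batch_center z b := ellipsoid_center (2 * rad) (cuts (2 * rad) (batch_means z b)).

Lemma batch_meansS z b : batch_means z b.+1 = batch_mean z b :: batch_means z b.
Proof. by rewrite /batch_means mkseqS rev_rcons. Qed.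

Lemma size_batch_means z b : size (batch_means z b) = b.
Proof. by rewrite size_rev size_mkseq. Qed.

(** A centre uses only the answers of earlier batches. Hence the queries of one batch coincide, and
    the centres recomputed from the full record are the points that were queried. *)
Lemma batch_center_take z b n : (b * m <= n)%N ->
  batch_center (take n z) b = batch_center z b.
Proof.
move=> bn; rewrite /batch_center /batch_means; congr (ellipsoid_center _ (cuts _ (rev _))).
apply/eq_in_map => c; rewrite mem_iota add0n => /andP[_ cb].
congr (_ *: _); apply: eq_bigr => i _; rewrite nth_take//.
apply: leq_trans bn; apply: (@leq_trans (c.+1 * m)%N); last by rewrite leq_mul2r cb orbT.
by rewrite mulSn addnC ltn_add2r.
Qed.

Lemma batch_center_enorm z b : enorm (batch_center z b) <= 2 * rad.
Proof. by apply: (ellipsoid_centerP _ _).1; rewrite mulr_ge0// ltW. Qed.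

Lemma mem_cuts_batch z b h : h \in cuts (2 * rad) (batch_means z b) ->
  exists2 c, (c < b)%N & h = (batch_mean z c, dotp (batch_mean z c) (batch_center z c)).
Proof.
elim: b => [|b IH]; first by [].
rewrite batch_meansS /= inE => /orP[/eqP ->|/IH[c cb ->]]; first by exists b.
by exists c => //; exact: ltnW.
Qed.

(** The condition involves the recorded answers alone, so that the output does not refer to the
    unknown function. *)
Definition batch_weights z : 'rV[R]_T := xget 0 [set l | in_simplex l /\
  forall y, enorm y <= rad ->
    \sum_(b < T) l ord0 b * dotp (batch_mean z b) (batch_center z b - y) <= tol].

Definition batch_output z := \sum_(b < T) batch_weights z ord0 b *: batch_center z b.

Variables (f : 'rV[R]_d -> R) (xs : 'rV[R]_d) (z : seq 'rV[int]_d) (theta G r c : R).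
Hypothesis T0 : (0 < T)%N.
Hypothesis df : forall x, differentiable f x.
Hypothesis cf : @convex_function R 'rV[R]_d setT f.
Hypothesis xsrad : enorm xs <= rad.
Hypothesis noise : forall b, (b < T)%N ->
  dotp (gradient f (batch_center z b) - batch_mean z b) (batch_center z b - xs) <= theta.
Hypothesis mean_le : forall b, (b < T)%N -> enorm (batch_mean z b) <= G.
Hypothesis c0 : 0 < c.
Hypothesis ctol : c < tol.
Hypothesis r0 : 0 < r.
Hypothesis rrad : r <= rad.
Hypothesis rG : r * G <= c.
Hypothesis small : (19 / 20) ^+ T * (d%:R * (2 * rad)) ^+ d < r ^+ d.

(** By [small], the region left after T cuts cannot hold a ball of radius r. *)
Lemma no_deep_point y : enorm y <= rad ->
  exists b : 'I_T, dotp (batch_mean z b) (batch_center z b - y) < c.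
Proof.
move=> yrad; apply/not_existsP => h.
have : r ^+ d <= (19 / 20) ^+ T * (d%:R * (2 * rad)) ^+ d.
  rewrite -{1}(size_batch_means z T).
  apply: (@cutting_plane R d (2 * rad) _ _ G c r y) => //.
  - by rewrite mulr_ge0// ltW.
  - by rewrite mulrC ler_pM2l.
  - move=> g; rewrite mem_rev => /mapP[b]; rewrite mem_iota add0n => /andP[_ bT] ->.
    exact: mean_le.
  - by rewrite mulrC ler_pM2l.
  move=> p /mem_cuts_batch[b bT ->] /=; have := h (Ordinal bT).
  by move/negP; rewrite -leNgt dotpBr /=; lra.
by rewrite leNgt small.
Qed.

Lemma batch_weightsP : in_simplex (batch_weights z) /\
  forall y, enorm y <= rad ->
    \sum_(b < T) batch_weights z ord0 b * dotp (batch_mean z b) (batch_center z b - y) <= tol.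
Proof.
rewrite /batch_weights; set S := [set _ | _].
suff /(xgetPex 0) : exists l, S l by []; rewrite /S {S}.
case: T T0 no_deep_point => // T' _ ndp.
(* The smoothing parameter for which c + rad e equals [tol]. *)
have e0 : 0 < (tol - c) / rad by rewrite divr_gt0 ?subr_gt0.
have [l l1 l2] := certificate (ltW rad0) e0 ndp.
exists l; split=> // y yrad; apply: le_trans (l2 y yrad) _.
by rewrite mulrC divfK ?gt_eqF//; lra.
Qed.

(** Convexity gives f(x_b) - f(xs) <= <grad f(x_b), x_b - xs>, and replacing the gradient by the
    batch mean costs theta. The weighted sum is bounded by the certificate at y = xs, and Jensen's
    inequality passes to the average. *)
Lemma batch_output_le : f (batch_output z) <= f xs + (tol + theta).
Proof.
have [[l0 l1] cert] := batch_weightsP.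
have jensen := convex_simplex (fun b : 'I_T => batch_center z b) df cf l0 l1.
apply: le_trans jensen _.
have := cert xs xsrad; set l := batch_weights z in l0 l1 *.
have h b : l ord0 b * f (batch_center z b) <= l ord0 b * f xs +
    (l ord0 b * dotp (batch_mean z b) (batch_center z b - xs) + l ord0 b * theta).
  rewrite -!mulrDr ler_wpM2l//.
  have := noise (ltn_ord b); rewrite dotpBl.
  have := convex_gradient_le xs (df (batch_center z b)) cf.
  rewrite -(opprB (batch_center z b)) dotpNr; lra.
have := ler_sum (index_enum 'I_T) (fun b _ => h b) (P := xpredT); rewrite !big_split/= -!mulr_suml l1 !mul1r.
lra.
Qed.

End BatchedAlgorithm.

(** * Probability of success *)

Section Oracle.
Context (R : realType) (d : nat) (dO : measure_display) (Omega : measurableType dO).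
Context (P : probability Omega R) (sigma s : R) (f : 'rV[R]_d -> R).
Context (O : 'rV[R]_d -> Omega -> 'rV[R]_d).
Hypothesis esgo : is_ESGO P sigma f O.
Hypothesis d0 : (0 < d)%N.
Hypothesis sigma0 : 0 < sigma.
Hypothesis s0 : 0 < s.
Hypothesis sigma_s : sigma / Num.sqrt d%:R <= s.
Variables (x : 'rV[R]_d).

Definition noise (u : 'rV[R]_d) (w : Omega) : R := dotp (O x w - gradient f x) u.

Lemma measurable_oracle_coord j : measurable_fun setT (fun w => O x w ord0 j).
Proof.
apply: (@measurableT_comp _ _ _ _ _ _ (fun v : borel_rV R d => (v : 'rV[R]_d) ord0 j)).
  exact: measurable_coord.
exact: (esgo.1 x).1.
Qed.

Lemma measurable_noise u : measurable_fun setT (noise u).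
Proof.
rewrite (_ : noise u = fun w => \sum_j (O x w ord0 j - gradient f x ord0 j) * u ord0 j).
  apply: measurable_sum => j; apply: measurable_funM => //.
  by apply: measurable_funB => //; exact: measurable_oracle_coord.
by apply/funext => w; apply: eq_bigr => j _; rewrite !mxE.
Qed.

Lemma noise_tail u (t : R) : enorm u = 1 -> 0 <= t ->
  (P [set w | (t <= `|noise u w|)%R] <= (2 * expR (- (t / s)))%:E)%E.
Proof.
move=> u1 t0; apply: le_trans (esgo.2 x u t u1 t0) _.
rewrite lee_fin ler_wpM2l// ler_expR lerN2.
have sd : 0 < Num.sqrt d%:R :> R by rewrite sqrtr_gt0 ltr0n.
rewrite -mulrA ler_wpM2l// -[leRHS]invf_div lef_pV2 ?posrE//.
exact: divr_gt0.
Qed.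

(** The mean of the oracle is given coordinatewise. Linearity needs each coordinate to be
    integrable, which follows from the tail bound in the coordinate directions. *)
Lemma noise_mean0 u : (\int[P]_w (noise u w)%:E = 0)%E.
Proof.
have coord j : P.-integrable setT (EFin \o (noise (delta_mx ord0 j))).
  apply: (integrable_subexp _ s0); first exact: measurable_noise.
  by move=> t t0; apply: noise_tail => //; rewrite enorm_delta.
have coordE j : noise (delta_mx ord0 j) = fun w => O x w ord0 j - gradient f x ord0 j.
  by apply/funext => w; rewrite /noise dotp_delta !mxE.
have cst_int (a : R) : P.-integrable setT (EFin \o cst a).
  exact: (finite_measure_integrable_cst P a).
have coordO j : P.-integrable setT (EFin \o (fun w => O x w ord0 j)).
  rewrite (_ : EFin \o _ = (EFin \o noise (delta_mx ord0 j)) \+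
    (EFin \o cst (gradient f x ord0 j)))%E.
    exact: integrableD.
  by apply/funext => w; rewrite /= coordE -EFinD subrK.
have coord0 j : (\int[P]_w (noise (delta_mx ord0 j) w)%:E = 0)%E.
  have EO : (\int[P]_w (O x w ord0 j)%:E = (gradient f x ord0 j)%:E)%E.
    by rewrite -(esgo.1 x).2 unlock.
  transitivity (\int[P]_w ((O x w ord0 j)%:E - (cst (gradient f x ord0 j) w)%:E))%E.
    by apply: eq_integral => w _; rewrite coordE EFinB.
  rewrite (integralB measurableT (coordO j) (cst_int _)).
  have -> : (\int[P]_w (cst (gradient f x ord0 j) w)%:E = (gradient f x ord0 j)%:E)%E.
    by rewrite (integral_cst _ measurableT (gradient f x ord0 j)%:E) [X in (_ * X)%E](@probability_setT _ _ _ P) mule1.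
  by rewrite EO subee.
transitivity (\int[P]_w (\sum_(j < d) (u ord0 j)%:E * (noise (delta_mx ord0 j) w)%:E))%E.
  apply: eq_integral => w _; rewrite sumEFin; congr EFin; apply: eq_bigr => j _.
  by rewrite /noise dotp_delta mulrC.
rewrite integral_sum//; last by move=> j; exact: (integrableZl measurableT _ (coord j)).
by rewrite big1// => j _; rewrite (integralZl measurableT (coord j)) coord0 mule0.
Qed.

End Oracle.

(** * Deviations of a batch given the rounded history *)

Section History.
Context (R : realType) (d N : nat) (dW dO : measure_display).
Context (W : measurableType dW) (Omega : measurableType dO).
Context (Pr : probability W R) (P : probability Omega R).
Context (sigma s theta tau : R) (f : 'rV[R]_d -> R) (O : 'rV[R]_d -> Omega -> 'rV[R]_d).
Context (xi : nat -> W -> Omega).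
Hypothesis mxi : forall t, (t < N)%N -> measurable_fun setT (xi t).
Hypothesis rect : forall B : nat -> set Omega, (forall t, measurable (B t)) ->
  (Pr (\bigcap_(t in `I_N) (xi t @^-1` B t)) = \prod_(t < N) P (B t))%E.
Hypothesis esgo : is_ESGO P sigma f O.
Hypothesis d0 : (0 < d)%N.
Hypothesis sigma0 : 0 < sigma.
Hypothesis s0 : 0 < s.
Hypothesis sigma_s : sigma / Num.sqrt d%:R <= s.
Hypothesis theta0 : 0 < theta.
Hypothesis theta_s : theta <= s.
Hypothesis tau0 : 0 < tau.
Variables (q : seq 'rV[int]_d -> nat -> 'rV[R]_d) (z : nat -> W -> seq 'rV[int]_d).
Hypothesis z0 : forall w, z 0 w = [::].
Hypothesis zS : forall n w,
  z n.+1 w = rcons (z n w) (grid_index tau (O (q (z n w) n) (xi n w))).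

Lemma size_history n w : size (z n w) = n.
Proof. by elim: n => [|n IH]; rewrite ?z0// zS size_rcons IH. Qed.

Lemma take_history k n w : (k <= n)%N -> take k (z n w) = z k w.
Proof.
elim: n => [|n IH]; first by rewrite leqn0 => /eqP ->; rewrite z0.
rewrite leq_eqVlt => /orP[/eqP ->|]; first by rewrite take_oversize// size_history.
by rewrite ltnS => kn; rewrite zS -cats1 take_cat size_history; move: kn;
  rewrite leq_eqVlt => /orP[/eqP ->|kn]; rewrite ?ltnn ?subnn ?take0 ?cats0// kn IH// ltnW.
Qed.

Lemma nth_history n t w : (t < n)%N ->
  nth 0 (z n w) t = grid_index tau (O (q (z t w) t) (xi t w)).
Proof.
by move=> tn; rewrite -(@nth_take t.+1 _ 0 t)// take_history// zS nth_rcons size_history ltnn eqxx.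
Qed.

(** Once the rounded answers are prescribed, every query is a fixed point, and each answer
    constrains one draw only. *)
Lemma history_rectangle n k : size k = n -> z n @^-1` [set k] =
  \bigcap_(t in `I_n) (xi t @^-1`
    [set w | grid_index tau (O (q (take t k) t) w) = nth 0 k t]).
Proof.
move=> kn; apply/seteqP; split => [w /= zk t /= tn|w /= h].
  by rewrite -zk take_history ?nth_history// ltnW.
have H j : (j <= n)%N -> z j w = take j k.
  elim: j => [|j IH] jn; first by rewrite z0 take0.
  by rewrite zS (take_nth 0) ?kn// IH ?(ltnW jn)// (h j jn).
by rewrite H// take_oversize// kn.
Qed.

(** On each history the query and the direction are constants, so Bernstein's inequality applies;
    the countably many histories are then put together. *)
Lemma block_deviation n m (dir : 'rV[R]_d -> 'rV[R]_d) : (n + m <= N)%N ->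
  (forall x, enorm (dir x) = 1) ->
  exists bad : set W, [/\ measurable bad,
    (Pr bad <= (2 * expR (- (m%:R * theta ^+ 2 / (48 * 64 * s ^+ 2))))%:E)%E &
    forall w, ~ bad w -> let x := q (z n w) n in
      `|\sum_(i < m) noise f O x (dir x) (xi (n + i) w)| < m%:R * theta].
Proof.
move=> nmN dir1.
pose badset k := [set w | m%:R * theta <=
  `|\sum_(i < m) noise f O (q k n) (dir (q k n)) (xi (n + i) w)|].
have mB k t : measurable [set w | grid_index tau (O (q (take t k) t) w) = nth 0 k t].
  rewrite -[X in measurable X]setTI.
  exact: (esgo.1 _).1 measurableT _ (measurable_grid_index tau0 (nth 0 k t)).
have nN : (n <= N)%N by rewrite (leq_trans _ nmN)// leq_addr.
have empty k : size k != n -> z n @^-1` [set k] = set0.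
  by move=> kn; apply/seteqP; split => // w /= zk; move: kn; rewrite -zk size_history eqxx.
have bern k := bernstein mxi rect nmN (mB k) (measurable_noise esgo (q k n) (dir (q k n))) s0
  (fun t t0 => noise_tail esgo d0 sigma0 s0 sigma_s (q k n) (dir1 (q k n)) t0)
  (noise_mean0 esgo d0 sigma0 s0 sigma_s (q k n) (dir (q k n))) theta0 theta_s.
have p0 : 0 <= 2 * expR (- (m%:R * theta ^+ 2 / (48 * 64 * s ^+ 2))).
  by rewrite mulr_ge0// expR_ge0.
have mh k : measurable (z n @^-1` [set k]).
  have [kn|kn] := eqVneq (size k) n; last by rewrite empty.
  by rewrite history_rectangle//; exact: (measurable_history mxi nN (mB k)).
have mbad k : measurable (z n @^-1` [set k] `&` badset k).
  have [kn|kn] := eqVneq (size k) n; last by rewrite empty// set0I.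
  by rewrite history_rectangle//; exact: (bern k).1.
have hbad k : (Pr (z n @^-1` [set k] `&` badset k) <=
    (2 * expR (- (m%:R * theta ^+ 2 / (48 * 64 * s ^+ 2))))%:E * Pr (z n @^-1` [set k]))%E.
  have [kn|kn] := eqVneq (size k) n; last by rewrite empty// set0I measure0 mule0.
  by rewrite history_rectangle//; exact: (bern k).2.
have [m1 p1] := countable_union_bound p0 mh mbad hbad.
exists [set w | badset (z n w) w]; split=> // w /= nbad; rewrite ltNge; exact/negP.
Qed.

End History.

(** The cases in which sigma / sqrt d or eps / (12 rad) would divide by zero. The minimizer is then
    0, and no query is made. *)
Lemma trivial_solves (R : realType) (d : nat) (L rad eps sigma : R) :
  0 < eps -> (d == 0)%N || (rad == 0) ->
  exists A : algorithm R d 0, solves_with_ESGO A L rad eps sigma (2 / 3).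
Proof.
move=> eps0 triv.
exists (@Algorithm R d 0 _ unit (dirac tt : probability unit R) (fun _ _ _ => 0) (fun _ _ => 0)
  (fun _ => @measurable_cst _ _ _ _ _ _) (@measurable_cst _ _ _ _ _ _)).
move=> f [_ _ _ [x minx xrad]] dO Omega P O _ dW W Pr zeta xi _.
exists setT; split => //; last by rewrite (@probability_setT _ _ _ Pr) lee_fin; lra.
move=> w _ /=; apply: (eps_optimal_minimizer minx); rewrite /run /=.
suff -> : x = 0 by lra.
case/orP: triv => [/eqP d0|/eqP r0].
  by apply/rowP => i; have := ltn_ord i; rewrite {2}d0.
by apply/eqP; rewrite -enorm_eq0 eq_le enorm_ge0 andbT -r0.
Qed.

Lemma union_bound (R : realType) (dW : measure_display) (W : measurableType dW)
    (Pr : probability W R) (I : finType) (bad : I -> set W) (p : R) :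
  (forall i, measurable (bad i)) -> (forall i, (Pr (bad i) <= p%:E)%E) ->
  exists E : set W, [/\ measurable E, (forall w i, E w -> ~ bad i w) &
    ((1 - #|I|%:R * p)%:E <= Pr E)%E].
Proof.
move=> mbad pbad; pose U := \bigcup_(i in [set` index_enum I]) bad i.
have UE : U = \big[setU/set0]_(i <- index_enum I) bad i by rewrite /U bigcup_seq.
have mU : measurable U by rewrite UE; apply: bigsetU_measurable => i _; exact: mbad.
have PU : (Pr U <= (#|I|%:R * p)%:E)%E.
  rewrite UE cardE mulr_natl -[enum I]filter_predT enumT.
  rewrite -[Finite.enum I]/(index_enum I) filter_predT; elim: (index_enum I) => [|i s IH].
    by rewrite big_nil measure0.
  have ms : measurable (\big[setU/set0]_(j <- s) bad j).
    by apply: bigsetU_measurable => j _; exact: mbad.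
  rewrite big_cons /= mulrS EFinD; apply: le_trans (measureU2 _ (mbad i) ms) _.
  exact: leeD (pbad i) IH.
exists (~` U); split.
- exact: measurableC.
- by move=> w i Uw bw; apply: Uw; exists i => //=; exact: mem_index_enum.
- by rewrite probability_setC// EFinB leeB.
Qed.

Section Algorithm.
Variables (R : realType) (d T m : nat) (rad tau tol : R).
Hypothesis tau0 : 0 < tau.

Definition batched_query (t : nat) (_ : unit) (h : t.-tuple (borel_rV R d)) : borel_rV R d :=
  batch_center m rad tau [seq grid_index tau a | a <- h] (t %/ m).

Definition batched_out (_ : unit) (h : (T * m).-tuple (borel_rV R d)) : borel_rV R d :=
  batch_output T m rad tau tol [seq grid_index tau a | a <- h].

Lemma measurable_batched_query (t : nat) :
  measurable_fun setT (fun p : unit * t.-tuple (borel_rV R d) => batched_query p.1 p.2).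
Proof.
exact: (measurable_grid_fun tau0 (fun z => batch_center m rad tau z (t %/ m))).
Qed.

Lemma measurable_batched_out :
  measurable_fun setT (fun p : unit * (T * m).-tuple (borel_rV R d) => batched_out p.1 p.2).
Proof. exact: (measurable_grid_fun tau0 (batch_output T m rad tau tol)). Qed.

Definition batched_algorithm : algorithm R d (T * m) :=
  @Algorithm R d (T * m) _ unit (dirac tt : probability unit R) batched_query batched_out
    measurable_batched_query measurable_batched_out.

End Algorithm.

Section Correctness.
Context (R : realType) (d T m : nat) (L rad eps sigma s theta : R).
Hypothesis L0 : 0 <= L.
Hypothesis rad0 : 0 < rad.
Hypothesis eps0 : 0 < eps.
Hypothesis sigma0 : 0 < sigma.
Hypothesis d0 : (0 < d)%N.
Hypothesis T0 : (0 < T)%N.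
Hypothesis m0 : (0 < m)%N.
Hypothesis thetaE : theta = eps / (12 * rad).
Hypothesis sigma_s : sigma / Num.sqrt d%:R <= s.
Hypothesis theta_s : theta <= s.
Hypothesis small : forall r : R, 0 < r -> r = Num.min rad (eps / 4 / (d%:R * (L + 2 * theta))) ->
  (19 / 20) ^+ T * (d%:R * (2 * rad)) ^+ d < r ^+ d.
Hypothesis failure :
  (T * d.+1)%:R * (2 * expR (- (m%:R * theta ^+ 2 / (48 * 64 * s ^+ 2)))) <= 1 / 3.

(** Rounding to this grid changes the component of an answer in a unit direction by at most tau d =
    theta. *)
Let tau := theta / d%:R.

Lemma theta_gt0 : 0 < theta.
Proof. by rewrite thetaE divr_gt0// mulr_gt0. Qed.

Lemma tau_gt0 : 0 < tau.
Proof. by rewrite divr_gt0 ?ltr0n// theta_gt0. Qed.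

(* The directions in which the error of a batch has to be controlled. *)
Definition direction (xs : 'rV[R]_d) (j : option 'I_d) (x : 'rV[R]_d) : 'rV[R]_d :=
  match j with
  | Some j => delta_mx ord0 j
  | None => if x == xs then delta_mx ord0 (Ordinal d0) else (enorm (x - xs))^-1 *: (x - xs)
  end.

Lemma enorm_direction xs j x : enorm (direction xs j x) = 1.
Proof.
case: j => [j|] /=; first exact: enorm_delta.
case: eqVneq => [_|xxs]; first exact: enorm_delta.
have e0 : enorm (x - xs) != 0 by rewrite enorm_eq0 subr_eq0.
by rewrite enormZ ger0_norm ?invr_ge0 ?enorm_ge0// mulVf.
Qed.

(** A union bound over T batches and d + 1 directions. The direction towards the minimizer controls
    the loss; the coordinate directions bound the means by G = d (L + 2 theta). Of eps, one half
    pays for noise and rounding, the other is the certificate tolerance, with cuts of depth eps /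
    4. *)
Lemma batched_solves :
  solves_with_ESGO (@batched_algorithm R d T m rad tau (eps / 2) tau_gt0) L rad eps sigma (2 / 3).
Proof.
move=> f [df cf Lf [xs minx xsrad]] dO Omega P O esgo dW W Pr zeta xi [mz mxi rect].
set A := batched_algorithm _ _ _ _ _ _.
have th0 := theta_gt0; have s0 : 0 < s by apply: lt_le_trans theta_s.
pose z n w := [seq grid_index tau a | a <- answers (zeta w : seed A) (fun t x => O x (xi t w)) n].
pose q (y : seq 'rV[int]_d) t := batch_center m rad tau y (t %/ m).
have z0 w : z 0%N w = [::] by [].
have zS n w : z n.+1 w = rcons (z n w) (grid_index tau (O (q (z n w) n) (xi n w))).
  by rewrite /z /= map_rcons.
have rect' B : (forall t, measurable (B t)) ->
    (Pr (\bigcap_(t in `I_(T * m)) (xi t @^-1` B t)) = \prod_(t < (T * m)) P (B t))%E.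
  move=> mB; have := rect setT B measurableT mB.
  rewrite preimage_setT setTI => ->.
  by rewrite [X in (X * _)%E](_ : _ = 1%E) ?mul1e//; exact: probability_setT.
(* All m calls of batch b query the same point, although the history grows between them. *)
have qE b i w : (i < m)%N -> q (z (b * m + i)%N w) (b * m + i) = batch_center m rad tau (z (b * m)%N w) b.
  move=> im; rewrite /q divnMDl// (divn_small im) addn0.
  by rewrite -(take_history z0 zS w (leq_addr i (b * m))) batch_center_take.
have dev (p : 'I_T * option 'I_d) := block_deviation mxi rect' esgo d0 sigma0 s0 sigma_s th0 theta_s
  tau_gt0 z0 zS (n := p.1 * m) (m := m) (dir := direction xs p.2).
have bnd (b : 'I_T) : (b * m + m <= T * m)%N by rewrite addnC -mulSn leq_mul2r ltn_ord orbT.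
have {}dev p := cid (dev p (bnd p.1) (enorm_direction xs p.2)).
pose bad p := projT1 (dev p).
have mbad p : measurable (bad p) by have [] := projT2 (dev p).
have pbad p : (Pr (bad p) <= (2 * expR (- (m%:R * theta ^+ 2 / (48 * 64 * s ^+ 2))))%:E)%E.
  by have [] := projT2 (dev p).
have devbad p w : ~ bad p w -> let x := q (z (p.1 * m)%N w) (p.1 * m)%N in
    `|\sum_(i < m) noise f O x (direction xs p.2 x) (xi (p.1 * m + i)%N w)| < m%:R * theta.
  by have [_ _] := projT2 (dev p); exact.
have [E [mE Ebad PE]] := union_bound mbad pbad.
exists E; split => //; last first.
  by apply: le_trans PE; rewrite lee_fin card_prod card_option !card_ord; have := failure; lra.
move=> w Ew /=; apply: (eps_optimal_minimizer minx).
pose zz := z (T * m)%N w.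
change (f (batch_output T m rad tau (eps / 2) zz) <= f xs + eps).
pose x b := batch_center m rad tau zz b.
have xE (b : 'I_T) : q (z (b * m)%N w) (b * m)%N = x b.
  have bT : (b * m <= T * m)%N by rewrite leq_mul2r ltnW ?orbT.
  rewrite /q mulnK// /x -[in RHS](batch_center_take _ _ _ (leqnn (b * m))).
  by rewrite (take_history z0 zS).
have mR : 0 < m%:R :> R by rewrite ltr0n.
have dR : 0 < d%:R :> R by rewrite ltr0n.
have err (b : 'I_T) j : `|dotp (batch_mean m tau zz b - gradient f (x b))
    (direction xs j (x b))| <= 2 * theta.
  have /= := devbad (b, j) w (Ebad w _ Ew); rewrite xE; set u := direction xs j (x b) => dev_b.
  have u1 : enorm u = 1 by exact: enorm_direction.
  pose a (i : 'I_m) := O (x b) (xi (b * m + i)%N w).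
  have meanE : m%:R *: batch_mean m tau zz b = \sum_(i < m) grid_point tau (grid_index tau (a i)).
    rewrite /batch_mean scalerA mulfV ?gt_eqF// scale1r; apply: eq_bigr => i _.
    have bi : (b * m + i < T * m)%N by apply: leq_trans (bnd b); rewrite ltn_add2l.
    rewrite (nth_history z0 zS)// qE// /a -xE /q mulnK//.
  rewrite -(ler_pM2l mR) -[X in X * `|_|]ger0_norm ?(ltW mR)// -normrM -dotpZl scalerBr meanE.
  have -> : dotp (\sum_(i < m) grid_point tau (grid_index tau (a i)) - m%:R *: gradient f (x b)) u =
      \sum_(i < m) dotp (grid_point tau (grid_index tau (a i)) - a i) u +
      \sum_(i < m) noise f O (x b) u (xi (b * m + i)%N w).
    rewrite -big_split/= dotpBl dotpZl dotp_suml.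
    rewrite (_ : m%:R * _ = \sum_(i < m) dotp (gradient f (x b)) u); last first.
      by rewrite sumr_const card_ord mulr_natl.
    by rewrite -sumrB; apply: eq_bigr => i _; rewrite /noise !dotpBl -/(a i); ring.
  have rnd : `|\sum_(i < m) dotp (grid_point tau (grid_index tau (a i)) - a i) u| <= m%:R * theta.
    apply: le_trans (ler_norm_sum _ _ _) _.
    apply: (@le_trans _ _ (\sum_(i < m) theta)); last by rewrite sumr_const card_ord mulr_natl.
    apply: ler_sum => i _; apply: le_trans (grid_point_index tau_gt0 _ _) _; first by rewrite u1.
    by rewrite /tau divfK ?gt_eqF.
  by apply: le_trans (ler_normD _ _) _; lra.
have grad_coord (b : nat) i : `|gradient f (x b) ord0 i| <= L.
  rewrite -dotp_delta ler_norml; apply/andP; split.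
    rewrite lerNl -dotpNr; apply: le_trans (gradient_enorm_le _ (df _) Lf) _.
    by rewrite enormN enorm_delta mulr1.
  by apply: le_trans (gradient_enorm_le _ (df _) Lf) _; rewrite enorm_delta mulr1.
have Lth : 0 < L + 2 * theta by have := L0; lra.
have G0 : 0 < d%:R * (L + 2 * theta) by rewrite mulr_gt0.
pose r := Num.min rad (eps / 4 / (d%:R * (L + 2 * theta))).
have r0 : 0 < r by rewrite lt_min rad0/= divr_gt0// divr_gt0.
have out := @batch_output_le R d T m rad tau (eps / 2) rad0 f xs zz (eps / 2)
  (d%:R * (L + 2 * theta)) r (eps / 4) T0 df cf xsrad.
apply: le_trans (out _ _ _ _ r0 _ _ _) _; last by rewrite lerD2l; lra.
- move=> b bT; rewrite -/(x b); have := err (Ordinal bT) None; rewrite /direction /=.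
  have [->|xxs] := eqVneq (x b) xs; first by rewrite subrr dotp0r; have := eps0; lra.
  have e0 : 0 < enorm (x b - xs) by rewrite enorm_gt0 subr_eq0.
  rewrite dotpZr normrM gtr0_norm ?invr_gt0// ler_pdivrMl// => h.
  rewrite -opprB dotpNl; apply: le_trans (ler_norm _) _; rewrite normrN.
  apply: le_trans h _.
  (* The centre has norm at most 2 rad and [xs] at most rad. Sampling and rounding err by theta
     each, so the loss is 3 rad * 2 theta = eps / 2, whence the 12 in [theta]. *)
  have x3 : enorm (x b - xs) <= 3 * rad.
    apply: le_trans (enormB _ _) _; have := batch_center_enorm m tau rad0 zz b.
    have := xsrad; rewrite -/(x b); lra.
  have -> : eps / 2 = 3 * rad * (2 * theta) by rewrite thetaE; field; rewrite gt_eqF.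
  by rewrite ler_pM2r//; lra.
- move=> b bT; rewrite mulrC; apply: enorm_le_coord => i.
  have := err (Ordinal bT) (Some i); rewrite /direction /= dotpBl !dotp_delta => h.
  rewrite -[_ ord0 i](subrK (gradient f (x b) ord0 i)).
  by apply: le_trans (ler_normD _ _) _; have := grad_coord b i; lra.
- by rewrite divr_gt0.
- by have := eps0; lra.
- by rewrite ge_min lexx.
- by rewrite -ler_pdivlMr// ge_min lexx orbT.
- exact: small r0 erefl.
Qed.


End Correctness.

(** * Query count *)

Section Counting.
Variable R : realType.
Implicit Types x y : R.

Lemma truncnS_le y : 0 <= y -> (Num.truncn y).+1%:R <= y + 1.
Proof. by move=> y0; rewrite -natr1 lerD2r; have /andP[] := truncn_itv y0. Qed.

Lemma ln_ge_half x : 2 <= x -> 1 / 2 <= ln x.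
Proof.
move=> x2; rewrite -[leLHS]expRK ler_ln ?posrE ?expR_gt0//; last lra.
by have /andP[_ h] := expR_half_bounds R; lra.
Qed.

Lemma expRM_ln x n : 0 < x -> expR (n%:R * ln x) = x ^+ n.
Proof. by move=> x0; rewrite expRM_natl lnK. Qed.

(** Since 19/20 <= exp(-1/20), each cut gains 1/20 in the exponent, against the initial excess of at
    most n d ln x. *)
Lemma contraction_power (d n T : nat) x y : 2 <= x -> 0 < y -> y <= x ^+ n -> (0 < d)%N ->
  20 * (n * d)%:R * ln x < T%:R -> (19 / 20) ^+ T * y ^+ d < 1.
Proof.
move=> x2 y0 yx d0 hT; have x0 : 0 < x by lra.
have h1 : (19 / 20) ^+ T <= expR (- (T%:R / 20)) :> R.
  have -> : expR (- (T%:R / 20)) = expR (- (1 / 20)) ^+ T :> R.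
    by rewrite -expRM_natl; congr expR; field.
  apply: lerXn2r; rewrite ?nnegrE ?expR_ge0//.
  by have := expR_ge1Dx (- (1 / 20) : R); lra.
have h2 : y ^+ d <= expR ((n * d)%:R * ln x).
  by rewrite expRM_ln// exprM lerXn2r ?nnegrE ?exprn_ge0// ltW.
have c0 : 0 <= (19 / 20 : R) by lra.
apply: le_lt_trans (ler_pM (exprn_ge0 T c0) (exprn_ge0 d (ltW y0)) h1 h2) _.
by rewrite -expRD -[ltRHS]expR0 ltr_expR; lra.
Qed.

(** With ei = 1 / eps, the left side is d (2 rad) / r for r = eps / (4 d (L + 2 theta)); the term
    1/6 is 2 theta rad / eps. *)
Lemma radius_ratio_le x (d L rad ei : R) : 2 <= x -> 0 <= d <= x -> 0 <= L <= x ->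
  0 <= rad <= x -> 0 <= ei <= x -> 8 * d ^+ 2 * (rad * L * ei + 1 / 6) <= x ^+ 9.
Proof.
move=> x2 /andP[d0 dx] /andP[L0 Lx] /andP[r0 rx] /andP[e0 ex].
have x0 : 0 <= x by lra.
have p3 : 8 <= x ^+ 3.
  have -> : 8 = 2 ^+ 3 :> R by rewrite -natrX.
  by apply: lerXn2r; rewrite ?nnegrE.
have d2 : d ^+ 2 <= x ^+ 2 by apply: lerXn2r; rewrite ?nnegrE.
have prod0 : 0 <= rad * L * ei by apply: mulr_ge0 => //; exact: mulr_ge0.
have prod3 : rad * L * ei <= x ^+ 3.
  rewrite (_ : x ^+ 3 = x * x * x); last by ring.
  by apply: ler_pM => //; [exact: mulr_ge0|exact: ler_pM].
have p4 : rad * L * ei + 1 / 6 <= x ^+ 4.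
  have := ler_wpM2r (exprn_ge0 3 x0) x2; rewrite -exprS; lra.
rewrite (_ : x ^+ 9 = x ^+ 3 * x ^+ 2 * x ^+ 4); last by ring.
have d20 := sqr_ge0 d.
by apply: ler_pM; [apply: mulr_ge0|lra|apply: ler_pM|].
Qed.

(** T is at most x^10 because 182 <= 2^8; the factor d + 1 costs one more power and the 6 three. *)
Lemma failure_ratio_le x (T d : nat) : 2 <= x -> d.+1%:R <= x ->
  T%:R <= 182 * (d%:R * ln x) -> (T * d.+1)%:R * 6 <= x ^+ 14.
Proof.
move=> x2 d1x hT; have x0 : 0 < x by lra.
have lx : ln x <= x by have := expR_ge1Dx (ln x); rewrite lnK ?posrE//; lra.
have l0 := ln_ge_half x2.
have dx : d%:R <= x by move: d1x; rewrite -natr1; lra.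
have p8 : 256 <= x ^+ 8.
  have -> : 256 = 2 ^+ 8 :> R by rewrite -natrX.
  by apply: lerXn2r; rewrite ?nnegrE// ltW.
have p3 : 8 <= x ^+ 3.
  have -> : 8 = 2 ^+ 3 :> R by rewrite -natrX.
  by apply: lerXn2r; rewrite ?nnegrE// ltW.
have dlx : d%:R * ln x <= x ^+ 2 by rewrite expr2 ler_pM//; lra.
have Tx : T%:R <= x ^+ 10.
  have := ler_wpM2r (sqr_ge0 x) p8; rewrite -exprD.
  by have := sqr_ge0 x; lra.
have Tdx : (T * d.+1)%:R <= x ^+ 11 by rewrite natrM (exprSr x 10) ler_pM.
have Td0 : 0 <= (T * d.+1)%:R :> R by [].
have e0 : 0 <= 8 :> R by [].
have := ler_pM Td0 e0 Tdx p3; rewrite -exprD; lra.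
Qed.

End Counting.

Theorem corollary3 (R : realType) :
  exists (C : R) (k : nat),
    forall (d : nat) (L rad eps sigma : R),
      0 <= L -> 0 <= rad -> 0 < eps -> 0 < sigma ->
      exists (N : nat) (A : algorithm R d N),
        N%:R <= C * ln (2 + eps^-1 + d%:R + rad + L) ^+ k *
                (rad ^+ 2 * sigma ^+ 2 / eps ^+ 2 + d%:R)
        /\ solves_with_ESGO A L rad eps sigma (2 / 3).
Proof.
(* 182 and 16 come from the bounds on T and m, 48 * 64 from Bernstein's inequality and 144 from
   theta = eps / (12 rad). T and m contribute one logarithm each. *)
pose C : R := 182 * 16 * (48 * 64) * 144.
have CE : C = 182 * 16 * (48 * 64) * 144 by [].
have C0 : 0 <= C by rewrite CE; lra.
clearbody C; exists C, 2%N => d L rad eps sigma L0 rad0 eps0 sigma0.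
set x := 2 + _ + _ + _ + _; set l := ln x.
have ei : 0 < eps^-1 by rewrite invr_gt0.
have dge0 : 0 <= d%:R :> R by [].
have x2 : 2 <= x by rewrite /x; lra.
have xd2 : d%:R + 2 <= x by rewrite /x; lra.
have xL : L <= x by rewrite /x; lra.
have xrad : rad <= x by rewrite /x; lra.
have xei : eps^-1 <= x by rewrite /x; lra.
have d1x : d.+1%:R <= x by rewrite -natr1; lra.
have xd : d%:R <= x by lra.
clearbody x; have x0 : 0 < x by lra.
have x1 : 1 <= x by lra.
have l2 : 1 / 2 <= l by exact: ln_ge_half.
have l0 : 0 <= l by lra.
have Q0 : 0 <= rad ^+ 2 * sigma ^+ 2 / eps ^+ 2 + d%:R.
  by apply: addr_ge0 => //; apply: divr_ge0; [apply: mulr_ge0|]; exact: sqr_ge0.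
have [triv|] := boolP ((d == 0)%N || (rad == 0)).
  have [A solA] := trivial_solves L sigma eps0 triv.
  exists 0%N, A; split => //; apply: mulr_ge0 => //.
  by apply: mulr_ge0 => //; exact: sqr_ge0.
rewrite negb_or -lt0n => /andP[d0 radn0].
have {radn0}radp : 0 < rad by rewrite lt0r radn0.
have dp : 1 <= d%:R :> R by rewrite ler1n.
have dp0 : 0 < d%:R :> R by rewrite ltr0n.
have xpow n : 1 <= x ^+ n by exact: exprn_ege1.
pose theta := eps / (12 * rad).
have th0 : 0 < theta by rewrite divr_gt0// mulr_gt0.
(* The summand theta^2 secures theta <= s, which Bernstein's inequality requires. It adds only a
   constant to the batch factor [V], and hence a multiple of d to d V. *)
pose s2 := sigma ^+ 2 / d%:R + theta ^+ 2.
have sg0 : 0 < sigma ^+ 2 / d%:R by rewrite divr_gt0 ?exprn_gt0//; lra.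
have th20 : 0 < theta ^+ 2 by rewrite exprn_gt0.
have thE : theta = eps / (12 * rad) by [].
have s20 : 0 < s2 by rewrite addr_gt0.
pose s := Num.sqrt s2.
have ss : s ^+ 2 = s2 by rewrite sqr_sqrtr// ltW.
have sp : 0 < s by rewrite sqrtr_gt0.
have sth : theta <= s by rewrite -ler_sqr ?nnegrE ?(ltW th0) ?(ltW sp)// ss lerDr ltW.
have ssig : sigma / Num.sqrt d%:R <= s.
  have h0 : 0 <= sigma / Num.sqrt d%:R by rewrite divr_ge0 ?sqrtr_ge0// ltW.
  rewrite -ler_sqr ?nnegrE ?(ltW sp)// ss exprMn exprVn sqr_sqrtr//.
  by rewrite lerDl ltW.
(* 180 is 20 * 9, with 20 from [contraction_power] and the exponent 9 from [radius_ratio_le]. *)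
pose T := (Num.truncn (180 * d%:R * l)).+1.
(* Bernstein's exponent is m / V, so m > 14 V ln x makes a single failure at most 2 x^-14 likely, as
   [failure_ratio_le] needs. *)
pose V := 48 * 64 * s2 / theta ^+ 2.
pose m := (Num.truncn (14 * V * l)).+1.
have dl0 : 0 <= 180 * d%:R * l by apply: mulr_ge0; lra.
have V1 : 1 <= V.
  rewrite /V ler_pdivlMr// mul1r /s2; lra.
have Vp : 0 < V by exact: lt_le_trans V1.
have Vl0 : 0 <= 14 * V * l by apply: mulr_ge0; lra.
have T1 : 180 * d%:R * l < T%:R := truncnS_gt _.
have T2 : T%:R <= 180 * d%:R * l + 1 := truncnS_le dl0.
have m1 : 14 * V * l < m%:R := truncnS_gt _.
have m2 : m%:R <= 14 * V * l + 1 := truncnS_le Vl0.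
(* This and its analogue for V absorb the 1 lost in rounding up: 180 becomes 182 and 14 becomes
   16. *)
have dl : 1 / 2 <= d%:R * l.
  by have : 1 * l <= d%:R * l; [rewrite ler_wpM2r//; lra|lra].
have T3 : T%:R <= 182 * (d%:R * l) by lra.
have Vl : 1 / 2 <= V * l.
  by have : 1 * l <= V * l; [rewrite ler_wpM2r//; lra|lra].
have m3 : m%:R <= 16 * (V * l) by lra.
(* The cancellation behind the rate: the d of the number of cuts meets the 1/d in the directional
   variance. *)
have dV : d%:R * V = 48 * 64 * (d%:R + 144 * (rad ^+ 2 * sigma ^+ 2 / eps ^+ 2)).
  by rewrite /V /s2 /theta; field; rewrite !gt_eqF//; lra.
have small r : 0 < r -> r = Num.min rad (eps / 4 / (d%:R * (L + 2 * theta))) ->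
    (19 / 20) ^+ T * (d%:R * (2 * rad)) ^+ d < r ^+ d.
  move=> r0 rE; rewrite -[ltRHS]mul1r -ltr_pdivrMr ?exprn_gt0// -mulrA -expr_div_n.
  have y0 : 0 < d%:R * (2 * rad) / r.
    by apply: divr_gt0 => //; apply: mulr_gt0 => //; exact: mulr_gt0.
  apply: (@contraction_power R d 9 T x) => //; last by rewrite natrM -/l; lra.
  have Lth : 0 < L + 2 * theta by lra.
  rewrite rE minEle; case: ifP => _.
    have -> : d%:R * (2 * rad) / rad = 2 * d%:R by field; rewrite gt_eqF.
    apply: (@le_trans _ _ (x ^+ 2)); first by rewrite expr2 ler_pM.
    by rewrite ler_weXn2l.
  have -> : d%:R * (2 * rad) / (eps / 4 / (d%:R * (L + 2 * theta))) =
     8 * d%:R ^+ 2 * (rad * L * eps^-1 + 1 / 6).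
    have -> : 1 / 6 = 2 * theta * rad / eps by rewrite /theta; field; rewrite !gt_eqF.
    by field; rewrite !gt_eqF.
  by apply: radius_ratio_le => //; apply/andP; split => //; exact: ltW.
have failure : (T * d.+1)%:R * (2 * expR (- (m%:R * theta ^+ 2 / (48 * 64 * s ^+ 2)))) <= 1 / 3.
  have -> : m%:R * theta ^+ 2 / (48 * 64 * s ^+ 2) = m%:R / V.
    by rewrite ss /V; field; rewrite !gt_eqF.
  have e1 : expR (- (m%:R / V)) <= (x ^+ 14)^-1.
    rewrite expRN lef_pV2 ?posrE ?expR_gt0//; last exact: lt_le_trans ltr01 (xpow _).
    by rewrite -expRM_ln// ler_expR ler_pdivlMr// -/l mulrAC ltW.
  have x14 : 0 < x ^+ 14 by exact: lt_le_trans ltr01 (xpow _).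
  have Tdx6 := failure_ratio_le x2 d1x T3.
  have Tdx : (T * d.+1)%:R / x ^+ 14 <= 1 / 6 by rewrite ler_pdivrMr//; lra.
  have := ler_wpM2l (ler0n R (T * d.+1)) e1; lra.
have sol := @batched_solves R d T m L rad eps sigma s theta L0 radp eps0 sigma0 d0 isT isT
  erefl ssig sth small failure.
exists (T * m)%N; eexists; split; last exact: sol.
have h1 : T%:R * m%:R <= (182 * (d%:R * l)) * (16 * (V * l)) by apply: ler_pM.
rewrite natrM; apply: le_trans h1 _.
have -> : 182 * (d%:R * l) * (16 * (V * l)) = 182 * 16 * l ^+ 2 * (d%:R * V) by ring.
rewrite dV; set q := rad ^+ 2 * _ / _ in Q0 *.
have q0 : 0 <= q by apply: divr_ge0; [apply: mulr_ge0|]; exact: sqr_ge0.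
have := mulr_ge0 (sqr_ge0 l) dge0; rewrite CE; lra.
Qed.
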